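(* Let $b>0$ be an integer, $q\ge 1$, and let $\Psi=\{\psi_n(\beta)\}_{\beta\in(0,b]}$ be an arbitrary admissible family of normalizations. I. For any $\alpha\in(0,b]$ such that $\psi_n(\alpha)\neq\varphi_n(\alpha)$, there exists an admissible family $\{\upsilon_n(\beta)\}_{\beta\in(0,b]}$ for which $$\lim_{n\to\infty}\upsilon_n(\alpha)\psi_n^{-1}(\alpha)=0 .$$ II. If there exists $\gamma\in(0,b)$ such that $$\lim_{n\to\infty}\psi_n(\gamma)\phi_n^{-1}(\gamma)=0,$$ then necessarily (a) $\displaystyle\lim_{n\to\infty}\psi_n(\beta)\phi_n^{-1}(\beta)>0$ for all $\beta\in(0,\gamma)$; (b) $\displaystyle\lim_{n\to\infty}\left[\frac{\psi_n(\gamma)}{\phi_n(\gamma)}\right]\left[\frac{\phi_n(\beta)}{\psi_n(\beta)}\right]=0$ for all $\beta\in(\gamma,b]$.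
   Context: Model. Let $d\ge1$. For $n\in\mathbb N^*$ (with $n^{1/d}$ an integer; limits $n\to\infty$ are along such $n$), the deterministic design points $X_1,\dots,X_n$ are the points of the grid $\{1/n^{1/d},2/n^{1/d},\dots,1\}^d\subset[0,1]^d$. One observes $Y^{(n)}=(X_i,Y_i)_{i=1,\dots,n}$ with $Y_i=f(X_i)\,U_i$, where $U_1,\dots,U_n$ are independent and uniformly distributed on $[0,1]$ and $f:[0,1]^d\to\mathbb R$ is unknown. $\mathbb E_f$ denotes expectation under the law of $Y^{(n)}$. The goal is to estimate $f$ at a given point $y\in[0,1]^d$. An estimator is a measurable function of $Y^{(n)}$. Hölder class. For $p\in\mathbb N^d$ put $|p|=p_1+\dots+p_d$; $\lfloor\beta\rfloor$ is the largest integer strictly less than $\beta$. For $\beta,L,M>0$, $\mathbb H_d(\beta,L,M)$ is the set of functions $f:[0,1]^d\to\mathbb R$ having on $[0,1]^d$ all partial derivatives of order $\lfloor\beta\rfloor$ and such that for all $x,z\in[0,1]^d$ $$\sum_{0\le|p|\le\lfloor\beta\rfloor}\sup_{x\in[0,1]^d}\left|\frac{\partial^{|p|}f(x)}{\partial x_1^{p_1}\cdots\partial x_d^{p_d}}\right|\le M,\qquad \left|f(x)-\sum_{0\le|p|\le\lfloor\beta\rfloor}\frac{\partial^{|p|}f(z)}{\partial z_1^{p_1}\cdots\partial z_d^{p_d}}\prod_{j=1}^d\frac{(x_j-z_j)^{p_j}}{p_j!}\right|\le L\sum_{j=1}^d|x_j-z_j|^\beta .$$ $\mathbb H_d(\beta,L,M,A)=\{g\in\mathbb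 H_d(\beta,L,M):\inf_{x\in[0,1]^d}g(x)\ge A\}$, with the standing assumption $0<A<M$. Risk. $R_{n,q}(\tilde f,\mathbb H_d(\beta,L,M,A))=\sup_{f\in\mathbb H_d(\beta,L,M,A)}\mathbb E_f|\tilde f(y)-f(y)|^q$. Normalizations. A family of normalizations is a family $\Psi=\{\psi_n(\beta)\}_{\beta\in(0,b]}$ of positive sequences. It is called admissible if there exists an estimator (sequence) $\hat f_n$ such that for some $L>0$, $M>0$, $A>0$ ($A<M$) $$\limsup_{n\to\infty}\psi_n^{-q}(\beta)\,R_{n,q}\big(\hat f_n,\mathbb H_d(\beta,L,M,A)\big)<\infty\qquad\forall\beta\in(0,b].$$ Finally $$\varphi_n(\beta)=n^{-\frac\beta{\beta+d}},\qquad \phi_n(\beta)=\Big(\frac{\rho_n(\beta)}{n}\Big)^{\frac\beta{\beta+d}},\qquad \rho_n(\beta)=1+\ln\Big(\frac{\varphi_n(\beta)}{\varphi_n(b)}\Big),\qquad \beta\in(0,b].$$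
   Formalization: In I, ''ψ_n(α) ≠ φ_n(α)'' is read as: the two are of the same order along no subsequence (literally false for ψ_n(α)=2φ_n(α)); in II(a), ''lim > 0'' is read as liminf > 0 (value +∞ allowed), since the limit need not exist. *)

(* Defs.v *)
From HB Require Import structures.
From mathcomp Require Import all_boot all_order all_algebra.
From mathcomp Require Import all_classical all_reals all_analysis.
Import Order.TTheory GRing.Theory Num.Theory.
Import numFieldNormedType.Exports.
Set Implicit Arguments.
Unset Strict Implicit.
Unset Printing Implicit Defensive.
Local Open Scope classical_set_scope.
Local Open Scope ring_scope.

Section Holder.
Context {R : realType} {d : nat}.
Implicit Types (f g : 'rV[R]_d -> R) (x z : 'rV[R]_d) (j : 'I_d).

Definition cube : set 'rV[R]_d := [set x | forall j, 0 <= x ord0 j <= 1].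

(* A function on the cube is represented by any extension of it to R^d. The
   derivatives below are limits of difference quotients whose increments stay
   in the cube (one-sided on the boundary), so that on the cube they depend
   only on the values taken on the cube. *)
Definition diff_quotient j f x (h : R) : R :=
  h^-1 * (f (x + h *: delta_mx ord0 j) - f x).

Definition increments j x : set_system R :=
  within [set h | cube (x + h *: delta_mx ord0 j)] (0 : R)^'.

Definition partial j f x : R := lim (diff_quotient j f x @ increments j x).

Definition has_partial j f : Prop :=
  forall x, cube x -> cvg (diff_quotient j f x @ increments j x).

(* All iterated partial derivatives of order at most k exist, in whatever
   order the differentiations are performed. *)
Definition has_partials (k : nat) f : Prop :=
  forall (s : seq 'I_d) j, (size s < k)%N -> has_partial j (foldr partial f s).

(* d^|p| f / dx_1^(p_1) ... dx_d^(p_d) *)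
Definition mpartial (k : nat) (p : {ffun 'I_d -> 'I_k}) f : 'rV[R]_d -> R :=
  foldr (fun j g => iter (p j) (partial j) g) f (enum 'I_d).

(* For beta > 0, the largest integer strictly less than beta; note that it is
   beta - 1 when beta is an integer. *)
Definition sfloor (beta : R) : nat := `|Num.ceil beta - 1|%N.

Definition holder (beta L M : R) : set ('rV[R]_d -> R) :=
  [set f | let k := sfloor beta in
   [/\ has_partials k f,
       (\sum_(p : {ffun 'I_d -> 'I_k.+1} | (\sum_j p j <= k)%N)
          ereal_sup [set `|mpartial p f x|%:E | x in cube] <= M%:E)%E &
       forall x z, cube x -> cube z ->
         `|f x - \sum_(p : {ffun 'I_d -> 'I_k.+1} | (\sum_j p j <= k)%N)
                   mpartial p f z *
                   \prod_j ((x ord0 j - z ord0 j) ^+ p j / (p j)`!%:R)|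
         <= L * \sum_j `|x ord0 j - z ord0 j| `^ beta]].

Definition holder_lb (beta L M A : R) : set ('rV[R]_d -> R) :=
  [set g | holder beta L M g /\
           (A%:E <= ereal_inf [set (g x)%:E | x in cube])%E].

End Holder.

Section Model.
Context {R : realType} (d : nat).

(* The grid {1/m, ..., 1}^d, whose n = m^d points are numbered through the
   base-m digits of i < m^d. *)
Definition design (m : nat) (i : 'I_(m ^ d)) : 'rV[R]_d :=
  \row_(j < d) ((i %/ m ^ j %% m).+1%:R / m%:R).

Context {disp : measure_display} {T : measurableType disp}.
Variables (P : probability T R) (U : nat -> {RV P >-> R}).

Definition iid_uniform : Prop :=
  (forall i (B : set R), measurable B ->
     distribution P (U i) B = uniform_prob (@ltr01 R) B) /\
  (forall n (B : 'I_n -> set R), (forall i, measurable (B i)) ->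
     P (\bigcap_(i : 'I_n) (U i @^-1` B i)) =
     (\prod_(i < n) P (U i @^-1` B i))%E).

Definition observations (f : 'rV[R]_d -> R) (m : nat) (w : T) :
    (m ^ d).-tuple R :=
  [tuple f (design i) * U i w | i < m ^ d].

Definition estimator : Type := forall n, {mfun n.-tuple R >-> R}.

Variables (y : 'rV[R]_d) (q : R).

(* Risk for n = m^d observations. *)
Definition risk (fhat : estimator) (m : nat) (F : set ('rV[R]_d -> R)) :
    \bar R :=
  ereal_sup [set ('E_P[(fun w => `|fhat (m ^ d)%N (observations f m w) - f y|
                               `^ q)%R])%E | f in F].

(* Sequences are indexed by n, and only the values at n = m^d matter: every
   limit along the admissible n is a limit in m. *)
Definition normalizations (b : R) (psi : R -> nat -> R) : Prop :=
  forall beta, 0 < beta <= b -> forall m, (0 < m)%N -> 0 < psi beta (m ^ d)%N.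

Definition admissible (b : R) (psi : R -> nat -> R) : Prop :=
  normalizations b psi /\
  exists fhat : estimator, exists L M A : R,
    [/\ 0 < L, 0 < M, 0 < A, A < M &
     forall beta, 0 < beta <= b ->
       (limn_esup (fun m => ((psi beta (m ^ d)%N `^ (- q))%:E *
                             risk fhat m (holder_lb beta L M A))%E)
        < +oo)%E].

End Model.

Section Rates.
Context {R : realType}.
Variables (d : nat) (b : R).

Definition varphi (beta : R) (n : nat) : R :=
  n%:R `^ (- (beta / (beta + d%:R))).

Definition rho (beta : R) (n : nat) : R :=
  1 + ln (varphi beta n / varphi b n).

Definition phi (beta : R) (n : nat) : R :=
  (rho beta n / n%:R) `^ (beta / (beta + d%:R)).

End Rates.

(* u and v differ as rates of convergence: they are of the same order along no
   subsequence. Rates are only meaningful up to multiplicative constants. *)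
Definition rate_neq (R : realType) (u v : nat -> R) : Prop :=
  forall C : R, 0 < C ->
    \forall m \near \oo, ~ (C^-1 * v m <= u m <= C * v m).

(* Main.v *)
Require Import Defs.
From HB Require Import structures.
From mathcomp Require Import all_boot all_order all_algebra.
From mathcomp Require Import all_classical all_reals all_analysis.
From mathcomp Require Import measurable_realfun ring lra.
Import Order.TTheory GRing.Theory Num.Theory.
Import numFieldNormedType.Exports.
Set Implicit Arguments.
Unset Strict Implicit.
Unset Printing Implicit Defensive.
Local Open Scope classical_set_scope.
Local Open Scope ring_scope.

(* The bounds compare two functions. Conditionally on [U_i < a_i] for all [i],
   the vector [(U_i)] is distributed as [(a_i U_i)]; so lowering a constant
   function by a bump of height [lam h^beta] and width [h] at [y] multiplies
   expectations of nonnegative statistics by at most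
   [prod_i a_i^-1 <= exp (K n h^(beta + d))]. With [n h^(beta + d) = 1] this
   gives [psi >= c varphi] for every admissible family. With
   [n h^(beta + d) = kappa rho_n(beta)] and [kappa] small, the factor is a small
   power of [n], and [psi(gamma) <= phi(gamma)] forces [psi(beta) >= c phi(beta)]
   for [beta < gamma]; part II follows from this dichotomy, used with [gamma] as
   the larger exponent for (a) and as the smaller one for (b).

   For part I, [psi(alpha)] is of larger order than [varphi(alpha)], and
   [upsilon := varphi] at [alpha], [1] elsewhere, is admissible as soon as some
   bounded estimator is minimax on the single class of exponent [alpha]. Such an
   estimator is the element of a net of mesh [varphi_n(alpha)] of polynomials
   that has the smallest sum over a window of width [n^(-1/(alpha + d))] around
   [y], among those lying above all observations of the window: a polynomial [P]
   lies above them with probability at most [exp (- sum (f - P)^+ / M)], so an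
   element at distance [t] mesh sizes from the best one is selected with
   probability at most [C exp (- c t)]. *)

(** * A compactly supported spline and Taylor bounds *)

(** Admissibility fixes [L], [M], [A] once for all exponents, so the constant [(A + M) / 2] lies in
    every class at once. Hence one of the two functions compared is constant: the bump is rough, and
    the smoothness [gamma] enters through the constant alone. The comparison of laws goes one way,
    since lowering the function shrinks the support of the observations; so the bump is subtracted,
    never added.

    In the adaptive bound the exponential factor has to be beaten by the polynomial gap between
    [phi] at [gamma] and [phi] at [beta]; it can be, because [rho] grows at most like [ln n].

    Selecting by smallest sum turns a two-sided error into a one-sided one: if [v] has no larger sum
    than a good element [vs] lying above the function, then [vs - v] has nonnegative sum, so its
    positive part carries at least half of the l1 distance. On polynomials that distance is
    comparable to the number of window points times the distance of node values. With mesh times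
    number of points of order 1, each mesh step costs a constant factor in probability, and the sum
    over the net is bounded whatever its size. *)

Lemma is_derive_pos2 (R : realType) (x : R) :
  is_derive x (1 : R) (fun t : R => Num.max 0 t ^+ 2) (2 * Num.max 0 x).
Proof.
have H : (fun h : R => h^-1 *: (Num.max 0 (h *: 1 + x) ^+ 2 - Num.max 0 x ^+ 2))
    @ 0^' --> 2 * Num.max 0 x.
  apply/cvgrPdist_le => e e0; near=> h.
  have h0 : h != 0 by near: h; exact: nbhs_dnbhs_neq.
  have he : `|h| <= e.
    near: h; apply: dnbhs0_le => //.
  rewrite /GRing.scale /= mulr1.
  have nh : 0 < `|h| by rewrite normr_gt0.
  rewrite -(ler_pM2l nh) -normrM mulrBr mulVKf//.
  (* The linearisation error is at most [h ^+ 2] in each sign case of [x] and [h + x], so the kink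
     at 0 is harmless. *)
  apply: le_trans (_ : `|h| * `|h| <= _); last by rewrite ler_wpM2l.
  rewrite -normrM -expr2 (ger0_norm (sqr_ge0 h)) ler_norml !maxEle.
  by case: ifPn => ?; case: ifPn => ?; nra.
split; last exact: (cvg_lim _ H).
by apply/cvg_ex; exists (2 * Num.max 0 x).
Unshelve. all: by end_near. Qed.

Lemma horner_bounded (R : realType) (p : {poly R}) (r : R) : 0 <= r ->
  exists C : R, forall t, `|t| <= r -> `|p.[t]| <= C.
Proof.
move=> r0; exists (\sum_(i < size p) `|p`_i| * r ^+ i) => t tr; rewrite horner_coef.
apply: le_trans (ler_norm_sum _ _ _) _; apply: ler_sum => i _.
by rewrite normrM normrX ler_wpM2l// lerXn2r ?nnegrE.
Qed.

Section spline.
Variables (R : realType) (N : nat).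

Let w : {poly R} := 1 - 'X^2.

(* [spline i] is the [i]-th derivative of [(max 0 w) ^ (N + 2)]. The factor
   [(max 0 w) ^ 2] is of class C^1 only, but survives [N] differentiations since
   [w * max 0 w = (max 0 w) ^ 2]. *)
Fixpoint spline_coef (i : nat) : {poly R} :=
  if i is i'.+1 then
    w * (spline_coef i')^`() + (N - i' + 2)%:R *: (w^`() * spline_coef i')
  else 1.

Definition spline (i : nat) (t : R) : R :=
  (spline_coef i * w ^+ (N - i)).[t] * Num.max 0 w.[t] ^+ 2.

Let wE t : w.[t] = 1 - t ^+ 2.
Proof. by rewrite !hornerE. Qed.

Lemma is_derive_spline i t : (i < N)%N -> is_derive t (1 : R) (spline i) (spline i.+1 t).
Proof.
move=> iN; rewrite /spline.
have [n En] : exists n, (N - i)%N = n.+1 by exists (N - i).-1; rewrite prednK// subn_gt0.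
have En1 : (N - i.+1)%N = n by rewrite subnS En.
set Q := spline_coef i * w ^+ (N - i).
have H1 := is_derive_poly Q t.
have H2 := is_derive_poly w t.
have H3 : is_derive t (1 : R) (fun t : R => Num.max 0 w.[t] ^+ 2)
    (w^`().[t] *: (2 * Num.max 0 w.[t])).
  have := @is_derive1_comp _ (fun x : R => Num.max 0 x ^+ 2) (horner w) t _ _
    (is_derive_pos2 w.[t]) H2. rewrite /GRing.scale/= mulrC; exact.
apply: (is_derive_eq (is_deriveM H1 H3)).
rewrite /Q En1 [spline_coef i.+1]/= En derivM deriv_exp.
generalize (spline_coef i) w => s v.
rewrite !(hornerM, hornerD, hornerZ, hornerMn) /GRing.scale/= /GRing.scale/= exprS.
rewrite !(hornerM, horner_exp) natrD -(mulr_natr _ n.+1).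
have M : v.[t] * Num.max 0 v.[t] = Num.max 0 v.[t] ^+ 2.
  by rewrite maxEle; case: ifPn => ? //; rewrite expr2 mulr0 mul0r.
rewrite -!M.
set a := s.[t]; set b := s^`().[t]; set W := v.[t]; set W' := v^`().[t].
ring.
Qed.

Lemma spline_eq0 i t : 1 <= `|t| -> spline i t = 0.
Proof.
move=> t1; rewrite /spline wE; rewrite (_ : Num.max 0 _ = 0) ?expr0n ?mulr0//.
apply/max_idPl; rewrite subr_le0 -real_normK ?num_real//.
by rewrite exprn_ege1.
Qed.

Lemma spline00 : spline 0 0 = 1.
Proof.
rewrite /spline /= mul1r wE horner_exp wE expr0n/= subr0 !expr1n.
by rewrite (max_idPr ler01) expr1n mulr1.
Qed.

Lemma spline0_ge0_le1 t : 0 <= spline 0 t <= 1.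
Proof.
have [t1|t1] := leP 1 `|t|; first by rewrite spline_eq0// lexx ler01.
rewrite /spline /= mul1r horner_exp !wE.
have W : 0 <= 1 - t ^+ 2 <= 1.
  rewrite gerBl sqr_ge0 andbT subr_ge0 -real_normK ?num_real//.
  by rewrite exprn_ile1// ltW.
move: W => /andP[W0 W1].
rewrite (max_idPr W0) -exprD exprn_ge0//=.
exact: exprn_ile1.
Qed.

Lemma spline_bounded i : exists C : R, forall t, `|spline i t| <= C.
Proof.
have [C HC] := horner_bounded (spline_coef i * w ^+ (N - i)) ler01.
have C0 : 0 <= C by apply: le_trans (HC 0 _); rewrite ?normr0.
exists C => t; have [t1|t1] := leP 1 `|t|; first by rewrite spline_eq0// normr0.
rewrite /spline normrM -[leRHS]mulr1; apply: ler_pM => //; first exact/HC/ltW.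
have W : 0 <= 1 - t ^+ 2 <= 1.
  rewrite gerBl sqr_ge0 andbT subr_ge0 -real_normK ?num_real//.
  by rewrite exprn_ile1// ltW.
move: W => /andP[W0 W1].
rewrite wE (max_idPr W0) ger0_norm ?sqr_ge0//.
exact: exprn_ile1.
Qed.

End spline.

(** [g i] stands for the [i]-th derivative of [g 0]. Passing the whole family makes differentiation
    a shift of the index. *)
Definition taylor_poly (R : realType) (k : nat) (g : nat -> R -> R) (v : R) :
  {poly R} := \sum_(i < k) (g i v / i`!%:R) *: ('X - v%:P) ^+ i.

Lemma deriv_taylor_poly (R : realType) k (g : nat -> R -> R) v :
  (taylor_poly k.+1 g v)^`() = taylor_poly k (fun i => g i.+1) v.
Proof.
rewrite /taylor_poly big_ord_recl/= expr0 linearD/= derivZ derivC scaler0 add0r.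
rewrite linear_sum/=; apply: eq_bigr => i _; rewrite derivZ deriv_exp/=.
rewrite derivB derivX derivC subr0 mul1r /fintype.bump/= add0n.
rewrite -[X in _ *: X]scaler_nat scalerA; congr (_ *: _).
by rewrite factS natrM invfM -[LHS]mulrA mulrAC mulVf ?mul1r// pnatr_eq0.
Qed.

(** The remainder vanishes at [v] and its derivative is the remainder of the shifted family, so each
    induction step is one use of the mean value theorem. The factor [1 / k!] is given up. *)
Lemma taylor_bound (R : realType) (k : nat) (g : nat -> R -> R) (C : R) :
  (forall i t, (i < k)%N -> is_derive t (1 : R) (g i) (g i.+1 t)) ->
  (forall t, `|g k t| <= C) ->
  forall u v, `|g 0%N u - (taylor_poly k g v).[u]| <= C * `|u - v| ^+ k.
Proof.
elim: k g => [|k IH] g dg Cg u v.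
  by rewrite /taylor_poly big_ord0 horner0 subr0 mulr1.
have {}IH := IH (fun i => g i.+1) (fun i t ik => dg i.+1 t ik) Cg.
pose r t := g 0%N t - (taylor_poly k.+1 g v).[t].
have dr t : is_derive t (1 : R) r (g 1%N t - (taylor_poly k (fun i => g i.+1) v).[t]).
  have H := is_derive_poly (taylor_poly k.+1 g v) t.
  rewrite deriv_taylor_poly in H.
  by have := is_deriveB (dg 0%N t isT) H.
have cr A : {within A, continuous r}.
  apply: continuous_subspaceT => t.
  by apply/differentiable_continuous/derivable1_diffP; case: (dr t).
have rv : r v = 0.
  rewrite /r /taylor_poly horner_sum big_ord_recl/= big1 ?addr0 => [|i _].
    by rewrite expr0 !hornerE invr1 mulr1 subrr.
  by rewrite hornerZ horner_exp !hornerE subrr expr0n/= mulr0.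
suff [c H1 H2] : exists2 c, `|c - v| <= `|u - v| &
    `|r u - r v| = `|g 1%N c - (taylor_poly k (fun i => g i.+1) v).[c]| * `|u - v|.
  rewrite rv subr0 in H2; rewrite -/(r u) H2 exprSr mulrA ler_wpM2r//.
  apply: le_trans (IH c v) _; apply: ler_wpM2l; first exact: le_trans (Cg u).
  exact: lerXn2r.
have [uv|vu] := leP u v.
- have [c /itvP cuv E] := MVT_segment uv (fun x _ => dr x) (cr _).
  exists c; last by rewrite distrC E normrM (distrC v).
  by rewrite distrC (distrC u) !ger0_norm ?subr_ge0 ?cuv// lerD2l lerN2 cuv.
- have [c /itvP cuv E] := MVT_segment (ltW vu) (fun x _ => dr x) (cr _).
  exists c; last by rewrite E normrM.
  by rewrite !ger0_norm ?subr_ge0 ?cuv ?(ltW vu)// lerD2r cuv.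
Qed.

Lemma prod_norm_le (R : realDomainType) (I : finType) (a b : I -> R) :
  (forall i, `|a i| <= b i) -> `|\prod_i a i| <= \prod_i b i.
Proof.
by move=> ab; rewrite normr_prod; apply: ler_prod => i _; rewrite normr_ge0 ab.
Qed.

(** Factors are exchanged one at a time, each exchange costing at most [D ^+ n * e]. *)
Lemma prod_sub_le (R : realDomainType) (n : nat) (a b : 'I_n -> R) (D e : R) :
  1 <= D -> (forall i, `|a i| <= D) -> (forall i, `|b i| <= D) ->
  (forall i, `|a i - b i| <= e) ->
  `|\prod_i a i - \prod_i b i| <= n%:R * D ^+ n * e.
Proof.
move=> D1; have D0 : 0 <= D by lra.
elim: n a b => [|n IH] a b aD bD abe.
  by rewrite !big_ord0 subrr normr0 !mul0r.
have e0 : 0 <= e by apply: le_trans (abe ord0).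
rewrite !big_ord_recl/=.
set A := \prod_(i < n) _; set B := \prod_(i < n) _.
have -> : a ord0 * A - b ord0 * B = a ord0 * (A - B) + (a ord0 - b ord0) * B by ring.
apply: le_trans (ler_normD _ _) _; rewrite !normrM.
have H1 : `|a ord0| * `|A - B| <= D * (n%:R * D ^+ n * e).
  by apply: ler_pM => //; apply: IH.
have H2 : `|a ord0 - b ord0| * `|B| <= e * D ^+ n.
  apply: ler_pM => //; rewrite /B; apply: le_trans (prod_norm_le _) _.
    by move=> i; apply: bD.
  by rewrite prodr_const card_ord.
have H3 : e * D ^+ n <= e * D ^+ n * D by rewrite ler_peMr// mulr_ge0// exprn_ge0.
rewrite exprS -addn1 natrD; nra.
Qed.

Lemma sum_const_le (R : numDomainType) (I : finType) (P : pred I) (c : R) :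
  0 <= c -> \sum_(i | P i) c <= c *+ #|I|.
Proof.
move=> c0; rewrite -sumr_const big_mkcond/=.
by apply: ler_sum => i _; case: ifP.
Qed.

Section product_taylor.
Variables (R : realType) (d k : nat) (g : nat -> R -> R) (C : R).
Hypothesis d0 : (0 < d)%N.
Hypothesis C1 : 1 <= C.
Hypothesis dg : forall i t, (i < k.+1)%N -> is_derive t (1 : R) (g i) (g i.+1 t).
Hypothesis gC : forall i t, (i <= k.+1)%N -> `|g i t| <= C.

Let term (u v : 'I_d -> R) (p : {ffun 'I_d -> 'I_k.+1}) : R :=
  \prod_j (g (p j) (v j) * ((u j - v j) ^+ p j / (p j)`!%:R)).

Let term1_le (a r : R) (i : nat) t : (i <= k)%N -> `|a| <= r ->
  `|g i t * (a ^+ i / i`!%:R)| <= C * r ^+ i.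
Proof.
move=> ik ar; rewrite normrM ler_pM ?gC ?(leq_trans ik)//.
rewrite normrM normrX normfV normr_nat.
apply: le_trans (_ : `|a| ^+ i <= _); last first.
  by rewrite lerXn2r ?nnegrE ?(le_trans _ ar).
by rewrite ler_piMr ?exprn_ge0 ?invf_le1 ?ltr0n ?ler1n ?fact_gt0.

Qed.

Let term_le u v p (r : R) : (forall j, `|u j - v j| <= r) ->
  `|term u v p| <= C ^+ d * r ^+ (\sum_j p j).
Proof.
move=> H; have : `|term u v p| <= \prod_j (C * r ^+ p j).
  apply: prod_norm_le => j; apply: term1_le => //.
  by rewrite -ltnS.
by rewrite big_split/= prodr_const card_ord prodrXr.
Qed.

(** Let [r] be the largest [|u_j - v_j|]. If [r >= 1], the product is bounded and the Taylor sum is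
    of order [r ^ k <= r ^ beta]. If [r < 1], the product of the univariate Taylor polynomials is
    expanded: it is within order [r ^ (k + 1)] of the function, and so are its terms of total degree
    above [k]. *)
Lemma product_taylor_bound : exists2 D, 0 <= D &
  forall (beta : R) (u v : 'I_d -> R), k%:R < beta <= k.+1%:R ->
  `|\prod_j g 0%N (u j)
    - \sum_(p : {ffun 'I_d -> 'I_k.+1} | (\sum_j p j <= k)%N)
        \prod_j (g (p j) (v j) * ((u j - v j) ^+ p j / (p j)`!%:R))|
  <= D * \sum_j `|u j - v j| `^ beta.
Proof.
have C0 : 0 <= C := le_trans ler01 C1.
pose E : R := k.+1%:R * C.
have CE : C <= E by rewrite /E ler_peMl// ler1n.
pose n := #|{ffun 'I_d -> 'I_k.+1}|.
pose D1 := d%:R * E ^+ d * C.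
pose D2 := C ^+ d *+ n.
have D10 : 0 <= D1 by rewrite /D1 !mulr_ge0// exprn_ge0//; lra.
have D20 : 0 <= D2 by rewrite mulrn_wge0// exprn_ge0.
have D30 : 0 <= C ^+ d by rewrite exprn_ge0.
exists (D1 + D2 + C ^+ d) => [|beta u v /andP[kb bk]].
  by rewrite !addr_ge0.
have b0 : 0 < beta by apply: le_lt_trans kb.
pose jm := [arg max_(j > Ordinal d0) `|u j - v j|]%O.
pose r := `|u jm - v jm|.
have r0 : 0 <= r := normr_ge0 _.
have rj j : `|u j - v j| <= r.
  by rewrite /r /jm; case: arg_maxP => // i _; apply.
have rb : r `^ beta <= \sum_j `|u j - v j| `^ beta.
  by rewrite (bigD1 jm)//= lerDl sumr_ge0// => j _; rewrite powR_ge0.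
apply: le_trans (_ : (D1 + D2 + C ^+ d) * r `^ beta <= _); last first.
  by rewrite ler_wpM2l// !addr_ge0.
rewrite -/(term u v _); set S := \sum_(p | _) _.
have G0 : `|\prod_j g 0%N (u j)| <= C ^+ d.
  apply: le_trans (prod_norm_le (b := fun=> C) _) _; first by move=> j; exact: gC.
  by rewrite prodr_const card_ord.
have [r1|r1] := leP 1 r.
- have rk : r ^+ k <= r `^ beta.
    by rewrite -powR_mulrn// ler_powR// ltW.
  have R1 : 1 <= r `^ beta by apply: le_trans rk; rewrite exprn_ege1.
  have S0 : `|S| <= D2 * r `^ beta.
    apply: le_trans (ler_norm_sum _ _ _) _.
    apply: le_trans (_ : \sum_(p : {ffun 'I_d -> 'I_k.+1} | (\sum_j p j <= k)%N)
        C ^+ d * r `^ beta <= _).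
      apply: ler_sum => p pk; apply: le_trans (term_le _ rj) _.
      rewrite ler_wpM2l//; apply: le_trans rk; apply: ler_weXn2l => //.
    rewrite /D2 mulrnAl; apply: sum_const_le.
    by rewrite mulr_ge0// powR_ge0.
  apply: le_trans (ler_normB _ _) _.
  have := powR_ge0 r beta; nra.
- have rk : r ^+ k.+1 <= r `^ beta.
    have [->|rn0] := eqVneq r 0; first by rewrite expr0n powR0 ?gt_eqF.
    rewrite -powR_mulrn//; apply: ger_powR => //.
    by rewrite lt_neqAle eq_sym rn0 r0 ltW.
  pose Tj j := (taylor_poly k.+1 g (v j)).[u j].
  have TE j : Tj j = \sum_(i < k.+1) g i (v j) * ((u j - v j) ^+ i / i`!%:R).
    rewrite /Tj horner_sum; apply: eq_bigr => i _.
    by rewrite hornerZ horner_exp hornerXsubC -mulrA [_^-1 * _]mulrC.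
  have TjE j : `|Tj j| <= E.
    rewrite TE; apply: le_trans (ler_norm_sum _ _ _) _.
    apply: le_trans (_ : \sum_(i < k.+1) C <= _); last first.
      by rewrite sumr_const card_ord /E mulr_natl.
    apply: ler_sum => i _; apply: le_trans (term1_le _ _ (rj j)) _.
      by rewrite -ltnS.
    by rewrite ler_piMr// exprn_ile1// ltW.
  have E1 : 1 <= E := le_trans C1 CE.
  have H1 : `|\prod_j g 0%N (u j) - \prod_j Tj j| <= D1 * r ^+ k.+1.
    rewrite /D1 -mulrA; apply: prod_sub_le => // [j|j].
      by apply: le_trans CE; exact: gC.
    apply: le_trans (taylor_bound dg _ _ _) _ => [t|]; first exact: gC.
    by rewrite ler_wpM2l// lerXn2r ?nnegrE.
  have H2 : `|\prod_j Tj j - S| <= D2 * r ^+ k.+1.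
    have -> : \prod_j Tj j = \sum_p term u v p.
      under eq_bigr do rewrite TE.
      by rewrite bigA_distr_bigA.
    rewrite (bigID (fun p : {ffun 'I_d -> 'I_k.+1} => (\sum_j p j <= k)%N))/= -/S.
    rewrite addrC addrK.
    apply: le_trans (ler_norm_sum _ _ _) _.
    apply: le_trans (_ : \sum_(p : {ffun 'I_d -> 'I_k.+1} | ~~ (\sum_j p j <= k)%N)
         C ^+ d * r ^+ k.+1 <= _).
      apply: ler_sum => p pk; apply: le_trans (term_le _ rj) _.
      rewrite ler_wpM2l//; apply: ler_wiXn2l => //; first exact: ltW.
      by rewrite ltnNge.
    rewrite /D2 mulrnAl; apply: sum_const_le.
    by rewrite mulr_ge0// exprn_ge0.
  have := ler_normD (\prod_j g 0%N (u j) - \prod_j Tj j) (\prod_j Tj j - S).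
  rewrite addrA subrK => H3.
  have := powR_ge0 r beta.
  have := exprn_ge0 k.+1 r0; nra.
Qed.

End product_taylor.

(** * Partial derivatives within the cube *)

Lemma sfloor_bounds (R : realType) (beta : R) : 0 < beta ->
  (sfloor beta)%:R < beta <= (sfloor beta).+1%:R.
Proof.
move=> b0; rewrite /sfloor.
have c1 : 0 < Num.ceil beta by rewrite ceil_gt0.
have [n En] : exists n, Num.ceil beta = n.+1%:Z.
  by case: (Num.ceil beta) c1 => // -[|n] // _; exists n.
have -> : `|Num.ceil beta - 1|%N = n by rewrite En -addn1 PoszD addrK absz_nat.
have := ceil_itv beta; rewrite En => /andP[H1 H2].
apply/andP; split; last by apply: le_trans H2 _.
by apply: le_lt_trans H1; rewrite -addn1 PoszD addrK.
Qed.

Section partials.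
Variables (R : realType) (d : nat).
Implicit Types (f : 'rV[R]_d -> R) (x : 'rV[R]_d) (j : 'I_d).

Lemma shift_coord x j i (t : R) :
  (x + t *: delta_mx ord0 j) ord0 i = x ord0 i + t * (i == j)%:R.
Proof. by rewrite !mxE eqxx. Qed.

(** Makes the limits defining [partial] unique. From either half of [[0, 1]], small increments
    towards the other half stay in the cube. *)
Lemma increments_proper x j : cube x -> ProperFilter (increments j x).
Proof.
move=> cx; apply: Build_ProperFilter_ex => P; rewrite /increments /within /=.
move=> /nbhs_ballP[e /= e0 H].
pose t : R := Num.min (e / 2) 2^-1.
have t0 : 0 < t by rewrite lt_min divr_gt0//= invr_gt0.
have te : t < e.
  by apply: le_lt_trans (_ : e / 2 < e); [rewrite ge_min lexx|lra].
have t2 : t <= 2^-1 by rewrite ge_min lexx orbT.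
have cs s : 0 <= x ord0 j + s <= 1 -> cube (x + s *: delta_mx ord0 j).
  move=> Hs i; rewrite shift_coord; have [->|_] := eqVneq i j.
    by rewrite mulr1.
  by rewrite mulr0 addr0.
have /andP[x0 x1] := cx j.
have [x2|x2] := leP (x ord0 j) 2^-1.
- exists t; apply: H => /=.
  + by rewrite /ball/= sub0r normrN gtr0_norm.
  + by rewrite gt_eqF.
  + by apply: cs; apply/andP; split; lra.
- exists (- t); apply: H => /=.
  + by rewrite /ball/= sub0r opprK gtr0_norm.
  + by rewrite oppr_eq0 gt_eqF.
  + by apply: cs; apply/andP; split; lra.
Qed.

Lemma eq_diff_quotient_cvg f f' j x (l : R) : (forall z, cube z -> f z = f' z) ->
  cube x ->
  diff_quotient j f' x @ increments j x --> l ->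
  diff_quotient j f x @ increments j x --> l.
Proof.
move=> ff cx H; have FF := increments_proper j cx.
apply: cvg_trans H; apply: near_eq_cvg.
apply: filterS (near_withinT _ _) => h /= ch.
by rewrite /diff_quotient ff// ff.
Qed.

Lemma partial_eq f f' j x (l : R) : (forall z, cube z -> f z = f' z) ->
  cube x ->
  diff_quotient j f' x @ increments j x --> l -> partial j f x = l.
Proof.
move=> ff cx /(eq_diff_quotient_cvg ff cx) H.
have FF := increments_proper j cx.
exact: (cvg_lim _ H).
Qed.

Lemma diff_quotient_cvg f j x (F : R -> R) (l : R) :
  (forall t, f (x + t *: delta_mx ord0 j) = F (t + x ord0 j)) ->
  is_derive (x ord0 j) (1 : R) F l ->
  diff_quotient j f x @ increments j x --> l.
Proof.
move=> fF [dF <-]; apply: cvg_trans (_ : diff_quotient j f x @ 0^' --> _).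
  by apply: cvg_app; exact: cvg_within.
have -> : diff_quotient j f x =
    (fun h => h^-1 *: (F (h *: 1 + x ord0 j) - F (x ord0 j))).
  apply/funext => h; rewrite /diff_quotient fF /GRing.scale/= mulr1.
  by rewrite -{2}[x](addr0) -(scale0r (delta_mx ord0 j)) fF add0r.
exact: dF.
Qed.

(** Rewrites a multi-index derivative as a list of single ones, the form on which [has_partials] and
    the inductions below work. *)
Lemma foldr_iter_partial (m : 'I_d -> nat) f (s : seq 'I_d) :
  foldr (fun j g => iter (m j) (partial j) g) f s =
  foldr partial f (flatten [seq nseq (m j) j | j <- s]).
Proof.
elim: s => //= j s ->; rewrite foldr_cat.
by elim: (m j) => //= n ->.
Qed.

Lemma count_flatten_nseq (m : 'I_d -> nat) i :
  count_mem i (flatten [seq nseq (m j) j | j <- enum 'I_d]) = m i.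
Proof.
rewrite count_flatten -map_comp sumnE big_map big_enum/= (bigD1 i)//=.
rewrite count_nseq/= eqxx mul1n big1 ?addn0// => j ji.
by rewrite count_nseq/= (negbTE ji).
Qed.

Lemma size_flatten_nseq (m : 'I_d -> nat) :
  size (flatten [seq nseq (m j) j | j <- enum 'I_d]) = (\sum_j m j)%N.
Proof.
rewrite size_flatten /shape -map_comp sumnE big_map big_enum/=.
by apply: eq_bigr => j _; rewrite /= size_nseq.
Qed.

End partials.

(** * Bumps in the Holder class *)

Section perturbation.
Variables (R : realType) (d k : nat) (g : nat -> R -> R) (c a h : R).
Variable y : 'rV[R]_d.
Hypothesis dg : forall i t, (i < k)%N -> is_derive t (1 : R) (g i) (g i.+1 t).

(** Closed form, for all multi-indices [q] at once, of the derivative of order [q] of [c] minus a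
    bump of height [a] and width [h] at [y]: differentiating along [j] increments [q j], and [c]
    survives only at [q = 0]. *)
Definition perturbation (q : 'I_d -> nat) (x : 'rV[R]_d) : R :=
  c * [forall j, q j == 0%N]%:R -
  a * \prod_j (h^-1 ^+ q j * g (q j) ((x ord0 j - y ord0 j) / h)).

Lemma perturbation_diff_quotient (q : 'I_d -> nat) j x : (q j < k)%N ->
  diff_quotient j (perturbation q) x @ increments j x
    --> perturbation (fun i => (j == i) + q i)%N x.
Proof.
move=> qk; pose b := \prod_(i < d | i != j) (h^-1 ^+ q i * g (q i) ((x ord0 i - y ord0 i) / h)).
apply: (@diff_quotient_cvg _ _ _ _ _ (fun t => c * [forall j, q j == 0%N]%:R -
    a * (h^-1 ^+ q j * g (q j) ((t - y ord0 j) / h) * b))) => [t|].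
  rewrite /perturbation (bigD1 j)//= shift_coord eqxx mulr1 [t + _]addrC.
  congr (_ - _ * (_ * _)); apply: eq_bigr => i ij.
  by rewrite shift_coord (negbTE ij) mulr0 addr0.
have D1 : is_derive (x ord0 j) (1 : R) (fun t : R => (t - y ord0 j) / h) h^-1.
  have := is_derive_poly (h^-1 *: ('X - (y ord0 j)%:P)) (x ord0 j).
  rewrite derivZ derivXsubC hornerZ hornerC mulr1.
  by congr is_derive; apply/funext => t; rewrite hornerZ hornerXsubC mulrC.
have D2 := @is_derive1_comp _ (g (q j)) (fun t : R => (t - y ord0 j) / h) (x ord0 j) _ _
  (dg _ qk) D1.
have D3 := is_deriveZ (- a * (h^-1 ^+ q j * b)) D2.
have D4 := is_deriveD (is_derive_cst (c * [forall j, q j == 0%N]%:R) (x ord0 j) 1) D3.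
set F := (X in is_derive _ _ X _).
have FE : F = cst (c * [forall j, q j == 0%N]%:R) + (- a * (h^-1 ^+ q j * b)) \*:
    (g (q j) \o (fun t : R => (t - y ord0 j) / h)).
  by apply/funext => t; rewrite /F !fctE /=; rewrite /GRing.scale/=; ring.
rewrite FE; apply: (is_derive_eq D4).
rewrite /perturbation (_ : [forall _, _] = false); last first.
  by apply/negbTE/forallPn; exists j; rewrite eqxx.
rewrite mulr0 sub0r (bigD1 j)//= eqxx exprD expr1.
rewrite (eq_bigr (fun i => h^-1 ^+ q i * g (q i) ((x ord0 i - y ord0 i) / h))).
  by rewrite -/b /GRing.scale/=; ring.
by move=> i ij; rewrite eq_sym (negbTE ij).
Qed.

Lemma foldr_partial_perturbation (s : seq 'I_d) x : (size s <= k)%N -> cube x ->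
  foldr partial (perturbation (fun=> 0%N)) s x =
  perturbation (fun i => count_mem i s) x.
Proof.
elim: s x => [//|j s IH] x sk cx /=.
apply: (partial_eq (f' := perturbation (fun i => count_mem i s))) => //.
  by move=> z cz; apply: IH => //; exact: ltnW.
by apply: perturbation_diff_quotient; apply: leq_ltn_trans (count_size _ _) sk.
Qed.

Lemma has_partials_perturbation : has_partials k (perturbation (fun=> 0%N)).
Proof.
move=> s j sk x cx; apply/cvg_ex.
exists (perturbation (fun i => (j == i) + count_mem i s)%N x).
apply: (eq_diff_quotient_cvg (f' := perturbation (fun i => count_mem i s))) => //.
  by move=> z cz; apply: foldr_partial_perturbation => //; exact: ltnW.
by apply: perturbation_diff_quotient; apply: leq_ltn_trans (count_size _ _) sk.
Qed.

Lemma mpartial_perturbation (p : {ffun 'I_d -> 'I_k.+1}) x :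
  (\sum_j p j <= k)%N -> cube x ->
  mpartial p (perturbation (fun=> 0%N)) x = perturbation (fun j => p j) x.
Proof.
move=> pk cx; rewrite /mpartial foldr_iter_partial foldr_partial_perturbation//.
  by congr perturbation; apply/funext => i; rewrite count_flatten_nseq.
by rewrite size_flatten_nseq.
Qed.

End perturbation.

Lemma spline_bounded_le (R : realType) (N n : nat) :
  exists2 C : R, 1 <= C & forall i t, (i <= n)%N -> `|spline N i t| <= C.
Proof.
elim: n => [|n [C C1 HC]].
  have [C HC] := spline_bounded R N 0.
  exists (Num.max 1 C) => [|i t]; first by rewrite le_max lexx.
  by rewrite leqn0 => /eqP ->; rewrite le_max HC orbT.
have [C' HC'] := spline_bounded R N n.+1.
exists (Num.max C C') => [|i t]; first by rewrite le_max C1.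
rewrite leq_eqVlt => /predU1P[->|ilt]; first by rewrite le_max HC' orbT.
by rewrite le_max HC.
Qed.

(** Height [h ^ beta] and width [h] are matched: a derivative of order [i <= k < beta] has size at
    most [lam * h ^ (beta - i) <= lam] up to constants, and in the Taylor remainder the powers of
    [h] cancel exactly. The base [(A + M) / 2] leaves a margin [(M - A) / 2] on both sides. *)
Lemma holder_lb_perturbation (R : realType) (d : nat) (y : 'rV[R]_d)
    (beta L M A : R) :
  (0 < d)%N -> 0 < beta -> 0 < L -> 0 < A -> A < M ->
  exists2 lam0 : R, 0 < lam0 & forall lam h : R, 0 <= lam <= lam0 -> 0 < h <= 1 ->
    holder_lb beta L M A (fun x => (A + M) / 2 - lam * h `^ beta *
      \prod_j spline (sfloor beta).+1 0 ((x ord0 j - y ord0 j) / h)).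
Proof.
move=> d0 b0 L0 A0 AM; set k := sfloor beta; set g := spline k.+1.
have kb := sfloor_bounds b0; rewrite -/k in kb.
have dg i t : (i < k.+1)%N -> is_derive t (1 : R) (g i) (g i.+1 t).
  exact: is_derive_spline.
have [C C1 HC] := spline_bounded_le R k.+1 k.+1.
have C0 : 0 <= C := le_trans ler01 C1.
have [D D0 HD] := product_taylor_bound d0 C1 dg HC.
pose n : R := #|{ffun 'I_d -> 'I_k.+1}|%:R.
have n1 : 1 <= n.
  by rewrite /n ler1n; apply/card_gt0P; exists [ffun=> ord0].
have Cd1 : 1 <= C ^+ d by rewrite exprn_ege1.
(* The first bound brings the Taylor remainder below [L], where [D + 1] avoids dividing by 0; the
   second keeps the sum of the [n] derivative bounds within the margin. *)
pose lam0 := Num.min (L / (D + 1)) ((M - A) / 2 / (n * C ^+ d)).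
have nC : 1 <= n * C ^+ d by rewrite mulr_ege1.
have nC0 : 0 < n * C ^+ d := lt_le_trans ltr01 nC.
exists lam0 => [|lam h /andP[l0 lle] /andP[h0 h1]].
  by rewrite lt_min !divr_gt0//; lra.
have lL : lam * D <= L.
  have : lam <= L / (D + 1) by apply: le_trans lle _; rewrite ge_min lexx.
  by rewrite ler_pdivlMr; [nra|lra].
have lM : lam * (n * C ^+ d) <= (M - A) / 2.
  have : lam <= (M - A) / 2 / (n * C ^+ d).
    by apply: le_trans lle _; rewrite ge_min lexx orbT.
  by rewrite ler_pdivlMr.
set c := (A + M) / 2.
have c0 : 0 <= c by rewrite /c; lra.
pose a := lam * h `^ beta.
have a0 : 0 <= a by rewrite mulr_ge0// powR_ge0.
pose pert := perturbation g c a h y.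
have -> : (fun x : 'rV[R]_d => c - a * \prod_j g 0%N ((x ord0 j - y ord0 j) / h)) =
    pert (fun=> 0%N).
  apply/funext => x; rewrite /pert /perturbation (_ : [forall _, _]).
    by rewrite mulr1; congr (_ - _ * _); apply: eq_bigr => j _; rewrite expr0 mul1r.
  exact/forallP.
have dgk i t : (i < k)%N -> is_derive t (1 : R) (g i) (g i.+1 t).
  by move=> ik; apply: dg; exact: ltnW.
have hb i : (i <= k)%N -> h `^ beta * h^-1 ^+ i <= 1.
  move=> ik; rewrite exprVn -powR_mulrn ?(ltW h0)// -powRN -powRD; last first.
    by apply/implyP => _; rewrite gt_eqF.
  apply: le_trans (_ : h `^ 0 <= _); last by rewrite powRr0.
  apply: ger_powR; first by rewrite h0.
  move/andP: kb => [kb _]; rewrite subr_ge0; apply: ltW.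
  by apply: le_lt_trans kb; rewrite ler_nat.
have pertle (p : {ffun 'I_d -> 'I_k.+1}) x : (\sum_j p j <= k)%N ->
    `|pert (fun j => p j) x| <= c * (p == [ffun=> ord0])%:R + lam * C ^+ d.
  move=> pk; apply: le_trans (ler_normB _ _) _; apply: lerD.
    rewrite (ger0_norm (mulr_ge0 c0 (ler0n _ _))) ler_wpM2l// ler_nat.
    rewrite leq_eqVlt; apply/orP; left; apply/eqP; congr nat_of_bool.
    apply/forallP/eqP => [H|-> j]; last by rewrite ffunE.
    by apply/ffunP => j; rewrite ffunE; apply/val_inj/eqP/H.
  rewrite big_split/= prodrXr mulrA normrM.
  rewrite ger0_norm; last by rewrite mulr_ge0// exprn_ge0// invr_ge0 ltW.
  apply: ler_pM => //.
  - by rewrite mulr_ge0// exprn_ge0// invr_ge0 ltW.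
  - by rewrite /a -mulrA ler_piMr// hb.
  - apply: le_trans (prod_norm_le (b := fun=> C) _) _.
      move=> j; apply: HC; apply: leqW; rewrite -ltnS; exact: ltn_ord.
    by rewrite prodr_const card_ord.
have Hsplit : holder beta L M (pert (fun=> 0%N)).
  rewrite /holder /= -/k; split.
  - exact: has_partials_perturbation.
  - apply: le_trans (_ : (\sum_(p : {ffun 'I_d -> 'I_k.+1} | (\sum_j p j <= k)%N)
        (c * (p == [ffun=> ord0])%:R + lam * C ^+ d)%:E <= _)%E).
      apply: lee_sum => p pk; apply: ge_ereal_sup => _ [x cx <-].
      by rewrite lee_fin mpartial_perturbation// pertle.
    rewrite sumEFin lee_fin big_split/=.
    apply: le_trans (_ : c + lam * C ^+ d *+ #|{ffun 'I_d -> 'I_k.+1}| <= _); last first.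
      by rewrite -mulr_natr -/n /c; move: lM; rewrite (mulrC n) mulrA; lra.
    apply: lerD; last first.
      by apply: sum_const_le; rewrite mulr_ge0// exprn_ge0.
    rewrite (bigD1 [ffun=> ord0])/=; last first.
      by rewrite big1// => j _; rewrite ffunE.
    rewrite eqxx mulr1 big1 ?addr0// => p /andP[_ /negbTE ->].
    by rewrite mulr0.
  - move=> x z cx cz.
    pose u j := (x ord0 j - y ord0 j) / h; pose v j := (z ord0 j - y ord0 j) / h.
    have E : pert (fun=> 0%N) x - \sum_(p : {ffun 'I_d -> 'I_k.+1} | (\sum_j p j <= k)%N)
          mpartial p (pert (fun=> 0%N)) z *
            \prod_j ((x ord0 j - z ord0 j) ^+ p j / (p j)`!%:R) =
        - a * (\prod_j g 0%N (u j) -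
         \sum_(p : {ffun 'I_d -> 'I_k.+1} | (\sum_j p j <= k)%N)
          \prod_j (g (p j) (v j) * ((u j - v j) ^+ p j / (p j)`!%:R))).
      have pE0 w : pert (fun=> 0%N) w = c - a * \prod_j g 0%N ((w ord0 j - y ord0 j) / h).
        rewrite /pert /perturbation (_ : [forall _, _]); last exact/forallP.
        by rewrite mulr1; congr (_ - _ * _); apply: eq_bigr => j _; rewrite expr0 mul1r.
      rewrite pE0 -/(u _).
      rewrite /pert; under [X in _ - X = _]eq_bigr => p pk
        do rewrite (mpartial_perturbation _ _ _ _ dgk)// /perturbation mulrBl.
      rewrite sumrB (bigD1 [ffun=> ord0])/=; last first.
        by rewrite big1// => j _; rewrite ffunE.
      rewrite [X in _ - (X + _ - _)](_ : _ = c); last first.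
        rewrite (_ : [forall _, _]); last by apply/forallP => j; rewrite ffunE.
        by rewrite mulr1 big1 ?mulr1// => j _; rewrite ffunE expr0 fact0 divr1.
      rewrite [X in _ - (_ + X - _)](_ : _ = 0); last first.
        apply: big1 => p /andP[_ p0]; rewrite (_ : [forall _, _] = false) ?mulr0 ?mul0r//.
        apply/negbTE; apply: contra p0 => /forallP H; apply/eqP/ffunP => j.
        by rewrite ffunE; apply/val_inj/eqP/H.
      rewrite addr0; set S := \sum_(p | _) _; set S' := \sum_(p | _) _.
      suff -> : S = a * S' by ring.
      rewrite mulr_sumr; apply: eq_bigr => p pk; rewrite -mulrA -big_split/=.
      congr (_ * _); apply: eq_bigr => j _; rewrite /u /v -mulrBl opprB addrA subrK.
      rewrite expr_div_n exprVn; ring.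
    rewrite E normrM normrN (ger0_norm a0).
    apply: le_trans (_ : a * (D * \sum_j `|u j - v j| `^ beta) <= _).
      by rewrite ler_wpM2l// HD.
    have -> : \sum_j `|u j - v j| `^ beta =
        (h `^ beta)^-1 * \sum_j `|x ord0 j - z ord0 j| `^ beta.
      rewrite mulr_sumr; apply: eq_bigr => j _.
      rewrite /u /v -mulrBl opprB addrA subrK normrM powRM// mulrC.
      rewrite normfV (gtr0_norm h0); congr (_ * _).
      by rewrite -[h^-1]powR_inv1 ?(ltW h0)// -powRrM mulN1r powRN.
    rewrite /a mulrA mulrA ler_wpM2r//.
      by rewrite sumr_ge0// => j _; rewrite powR_ge0.
    by rewrite mulrAC mulfK// gt_eqF// powR_gt0.
split=> //; apply: le_ereal_inf_tmp => _ [x cx <-]; rewrite lee_fin.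
rewrite /pert /perturbation (_ : [forall _, _]); last exact/forallP.
have P1 : \prod_j (h^-1 ^+ 0 * g 0%N ((x ord0 j - y ord0 j) / h)) <= 1.
  apply: (@le_trans _ _ (\prod_(j < d) 1)); last by rewrite big1.
  apply: ler_prod => j _; by rewrite expr0 mul1r; exact: spline0_ge0_le1.
have P0 : 0 <= \prod_j (h^-1 ^+ 0 * g 0%N ((x ord0 j - y ord0 j) / h)).
  apply: prodr_ge0 => j _; rewrite expr0 mul1r.
  by have /andP[] := spline0_ge0_le1 k.+1 ((x ord0 j - y ord0 j) / h).
have al : a <= lam.
  by rewrite /a ler_piMr//; have := hb 0%N isT; rewrite expr0 mulr1.
have lM' : lam <= (M - A) / 2 by apply: le_trans lM; rewrite ler_peMr.
rewrite mulr1 lerBrDr -lerBrDl (le_trans (ler_piMr a0 P1))// (le_trans al)//.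
by apply: le_trans lM' _; rewrite /c; lra.
Qed.

(** * Change of measure *)

(** A generator closed under intersection, on which the law of an independent sample factors. The
    side [setT] lets a constraint on a single coordinate be a rectangle. *)
Lemma measurable_tuple_rectangles (R : realType) (n : nat) :
  (@measurable _ (n.-tuple R)) =
  <<s [set B : set (n.-tuple R) | exists2 b : 'I_n -> set R,
        forall i, b i = setT \/ exists x, b i = `]-oo, x[%classic &
        B = \bigcap_(i : 'I_n) ((fun t => tnth t i) @^-1` b i)] >>.
Proof.
set G := (X in <<s X >>); rewrite eqEsubset; split.
- apply: smallest_sub; first exact: smallest_sigma_algebra.
  rewrite -bigcup_seq; apply: bigcup_sub => i _.
  suff mf : measurable_fun setT ((fun t => tnth t i) : g_sigma_algebraType G -> R).
    by move=> _ [B mB <-]; exact: (mf measurableT B mB).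
  apply: (measurability _ (RGenInftyO.measurableE R)).
  move=> _ [_ [x ->] <-].
  apply: sub_sigma_algebra.
  exists (fun j => if j == i then `]-oo, x[%classic else setT).
    by move=> j; case: ifP => _; [right; exists x|left].
  rewrite setTI; apply/seteqP; split=> t /=.
    by move=> ti j _; case: eqP => [->|].
  by move=> /(_ i I); rewrite eqxx.
- apply: smallest_sub; first exact: sigma_algebra_measurable.
  move=> _ [b bE ->]; apply: fin_bigcap_measurable => [|i _]; first exact: finite_finset.
  rewrite -[X in measurable X]setTI; apply: measurable_tnth => //.
  by case: (bE i) => [->|[x ->]].
Qed.

(** The distribution function of the uniform law on [[0, 1]]. *)
Definition clamp (R : realType) (x : R) : R := Num.max 0 (Num.min 1 x).

Section iid.
Context {R : realType} {disp : measure_display} {T : measurableType disp}.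
Variables (P : probability T R) (U : nat -> {RV P >-> R}).
Hypothesis hU : iid_uniform U.

(** The boolean treats open and closed rays together: open ones generate the sigma-algebra, closed
    ones describe the event that a polynomial lies above the data. *)
Lemma uniform_ray i (c : bool) (x : R) :
  P (U i @^-1` [set` Interval -oo%O (BSide c x)]) = (clamp x)%:E.
Proof.
have [+ _] := hU; rewrite /distribution/pushforward => ->; last exact: measurable_itv.
rewrite /uniform_prob integral_uniform_pdf.
set B := _ `&` _.
have mB : measurable B by apply: measurableI; exact: measurable_itv.
rewrite (eq_integral (cst 1%:E)); last first.
  move=> z; rewrite inE => -[_]/=; rewrite in_itv/= /uniform_pdf => ->.
  by rewrite subr0 invr1.
rewrite integral_cst// mul1e /clamp /B.
have [x0|x0] := ltP x 0.
  rewrite (_ : _ `&` _ = set0) ?measure0.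
    by rewrite max_l// ge_min (ltW x0) orbT.
  apply/seteqP; split=> // z /= []; rewrite !in_itv/= => zx /andP[z0 _].
  have {}zx := lteifW zx.
  by have := le_trans z0 zx; rewrite leNgt x0.
have [x1|x1] := ltP 1 x.
  rewrite (_ : _ `&` _ = `[0, 1]%classic); last first.
    apply/seteqP; split=> z /=; rewrite !in_itv/=; first by case.
    move=> /andP[z0 z1]; rewrite z0 z1; split=> //; apply: lteifS.
    exact: le_lt_trans z1 x1.
  by rewrite /= lebesgue_measure_itv/= lte_fin ltr01 oppr0 adde0 max_r.
rewrite (_ : _ `&` _ = [set` Interval (BLeft 0) (BSide c x)]); last first.
  apply/seteqP; split=> z /=; rewrite !in_itv/=.
    by move=> [zx /andP[z0 z1]]; rewrite z0.
  move=> /andP[z0 zx]; rewrite z0 zx; split=> //=; apply: le_trans x1.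
  exact: lteifW zx.
rewrite /= lebesgue_measure_itv/= lte_fin max_r//; case: ifPn => [_|].
  by rewrite oppr0 adde0.
by rewrite -leNgt => x0'; congr EFin; apply/le_anti/andP.
Qed.

Lemma uniform_rectangle n (b : 'I_n -> set R) : (forall i, measurable (b i)) ->
  P (\bigcap_(i : 'I_n) (U i @^-1` b i)) = (\prod_(i < n) P (U i @^-1` b i))%E.
Proof. by move=> mb; have [_] := hU; apply. Qed.

Definition scaled_sample n (a : 'I_n -> R) (w : T) : n.-tuple R :=
  [tuple a i * U i w | i < n].

Lemma measurable_scaled_sample n (a : 'I_n -> R) :
  measurable_fun setT (scaled_sample a).
Proof.
apply/measurable_fun_tnthP => i.
rewrite (_ : _ \o _ = (fun w => a i * U i w)).
  exact: measurable_funM.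
by apply/funext => w /=; rewrite tnth_mktuple.
Qed.

HB.instance Definition _ n (a : 'I_n -> R) :=
  isMeasurableFun.Build _ _ _ _ (scaled_sample a) (measurable_scaled_sample a).

Lemma clamp_scale (a x : R) : 0 < a <= 1 -> a * clamp (a^-1 * x) = clamp (Num.min x a).
Proof.
move=> /andP[a0 a1]; rewrite /clamp.
rewrite maxr_pMr ?ltW// mulr0 minr_pMr ?ltW// mulr1 mulVKf ?gt_eqF//.
by rewrite [Num.min x a]minC minA (min_r a1).
Qed.

(* Given [U i < a i] for all [i], the vector [U] has the law of [a i * U i]. *)
Lemma scaled_sample_law_le n (a : 'I_n -> R) : (forall i, 0 < a i <= 1) ->
  forall B : set (n.-tuple R), measurable B ->
  ((\prod_i a i)%:E * distribution P (scaled_sample a) B <=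
   distribution P (scaled_sample (fun _ : 'I_n => 1%R)) B)%E.
Proof.
move=> a01.
have a0 i : 0 < a i by have /andP[] := a01 i.
have pa0 : 0 <= \prod_i a i by apply: prodr_ge0 => i _; exact: ltW.
pose E : set (n.-tuple R) := \bigcap_(i : 'I_n) ((fun t => tnth t i) @^-1` `]-oo, a i[%classic).
have mE : measurable E.
  apply: fin_bigcap_measurable => [|i _]; first exact: finite_finset.
  by rewrite -[X in measurable X]setTI; apply: measurable_tnth.
(* The identity of conditional laws, multiplied by the probability [\prod_i a i] of [E]: [m1] and
   [m2] agree on rectangles, and forgetting the restriction to [E] gives the inequality. *)
pose m1 : {measure set _ -> \bar R} :=
  mscale (NngNum pa0) (distribution P (scaled_sample a)).
pose m2 : {measure set _ -> \bar R} :=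
  mrestr (distribution P (scaled_sample (fun _ : 'I_n => 1%R))) mE.
have m12 : forall A, measurable A -> m1 A = m2 A.
  apply: (@measure_unique _ R (n.-tuple R) _ (fun=> setT)
    (measurable_tuple_rectangles R n) _ _ _ m1 m2).
  - move=> _ _ [b1 b1E ->] [b2 b2E ->]; exists (fun i => b1 i `&` b2 i).
      move=> i; have [->|[x1 ->]] := b1E i; have [->|[x2 ->]] := b2E i.
      + by left; rewrite setIid.
      + by right; exists x2; rewrite setTI.
      + by right; exists x1; rewrite setIT.
      + right; exists (Num.min x1 x2); apply/seteqP; split=> z /=; rewrite !in_itv/= lt_min.
          by case=> -> ->.
        by move=> /andP.
    apply/seteqP; split=> t /=; first by move=> [H1 H2] i _; split; [exact: H1|exact: H2].
    by move=> H; split=> i _; have [] := H i I.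
  - move=> _; exists (fun=> setT); first by left.
    by apply/seteqP; split=> t.
  - by apply/seteqP; split=> // t _; exists 0%N.
  - move=> _ [b bE ->]; rewrite /m1 /m2 /= /mscale /mrestr /distribution /pushforward /NngNum/=.
    rewrite [X in (_ * P X)%E](_ : _ =
        \bigcap_(i : 'I_n) (U i @^-1` ((fun u => a i * u) @^-1` b i))); last first.
      by apply/seteqP; split=> w /= H i _; have := H i I; rewrite /= tnth_mktuple.
    rewrite [X in _ = P X](_ : _ =
        \bigcap_(i : 'I_n) (U i @^-1` (b i `&` `]-oo, a i[%classic))); last first.
      apply/seteqP; split=> w /=.
        move=> [H1 H2] i _; have := H1 i I; have := H2 i I.
        by rewrite /= tnth_mktuple mul1r.
      move=> H; split=> i _; have [H1 H2] := H i I => //=.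
        by rewrite /= tnth_mktuple mul1r.
      by rewrite /= tnth_mktuple mul1r.
    have mb i : measurable (b i) by have [->|[x ->]] := bE i.
    rewrite !uniform_rectangle; last 2 first.
    + by move=> i; apply: measurableI.
    + move=> i; rewrite -[X in measurable X]setTI.
      have ma : measurable_fun setT (fun u : R => a i * u) by exact: measurable_funM.
      exact: (ma measurableT).
    rewrite -prodEFin -big_split/=; apply: eq_bigr => i _.
    have [->|[x ->]] := bE i.
      rewrite setTI preimage_setT preimage_setT probability_setT mule1.
      rewrite uniform_ray; congr EFin; have /andP[ai0 ai1] := a01 i.
      by rewrite /clamp (min_r ai1) (max_r (ltW ai0)).
    rewrite (_ : _ @^-1` _ = `]-oo, (a i)^-1 * x[%classic); last first.
      by apply/seteqP; split=> u /=; rewrite !in_itv/= ltr_pdivlMl.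
    rewrite (_ : _ `&` _ = `]-oo, Num.min x (a i)[%classic); last first.
      apply/seteqP; split=> z /=; rewrite !in_itv/= lt_min; first by case=> -> ->.
      by move=> /andP.
    by rewrite !uniform_ray -EFinM clamp_scale.
  - move=> _; rewrite /m1 /= /mscale/= /distribution/pushforward preimage_setT.
    by rewrite probability_setT mule1 ltry.
move=> B mB; have := m12 B mB; rewrite /m1 /m2 /= /mscale/= => ->.
rewrite /mrestr; apply: le_measure; rewrite ?inE//.
exact: measurableI.
Qed.

Lemma scaled_sample_integral_le n (a : 'I_n -> R) (G : n.-tuple R -> \bar R) :
  (forall i, 0 < a i <= 1) -> measurable_fun setT G -> (forall t, 0 <= G t)%E ->
  ((\prod_i a i)%:E * \int[P]_w G (scaled_sample a w) <=
   \int[P]_w G (scaled_sample (fun _ : 'I_n => 1%R) w))%E.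
Proof.
move=> a01 mG G0.
have pa0 : 0 <= \prod_i a i.
  by apply: prodr_ge0 => i _; have /andP[/ltW] := a01 i.
rewrite -[X in (_ * X)%E](@ge0_integral_distribution _ _ _ _ _ P (scaled_sample a) G)//.
rewrite -[leRHS](@ge0_integral_distribution _ _ _ _ _ P (scaled_sample (fun=> 1%R)) G)//.
have := @ge0_integral_mscale _ _ R (distribution P (scaled_sample a)) setT measurableT
  (NngNum pa0) G mG (fun x _ => G0 x).
move=> /= <-; apply: ge0_le_measure_integral => //= S mS.
exact: scaled_sample_law_le.
Qed.

End iid.

(** * Two-point lower bound *)

Lemma digits_inj (m d i i' : nat) : (i < m ^ d)%N -> (i' < m ^ d)%N ->
  (forall j, (j < d)%N -> i %/ m ^ j %% m = i' %/ m ^ j %% m)%N -> i = i'.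
Proof.
elim: d i i' => [|d IH] i i'; first by rewrite expn0 !ltnS !leqn0 => /eqP-> /eqP->.
move=> im im' H.
have m0 : (0 < m)%N by case: m im {IH im' H}; rewrite ?exp0n.
rewrite (divn_eq i m) (divn_eq i' m); congr (_ * _ + _)%N.
  apply: IH; [by rewrite ltn_divLR// -expnSr..|] => j jd.
  by have := H j.+1 jd; rewrite expnS !divnMA.
by have := H 0%N isT; rewrite expn0 !divn1.
Qed.

(** Lets sums over the numbered design become sums over multi-indices, which factor over the
    coordinates. *)
Lemma digits_bij (m d : nat) : (0 < m)%N ->
  exists2 ix : {ffun 'I_d -> 'I_m} -> 'I_(m ^ d), bijective ix &
    forall e (j : 'I_d), (ix e %/ m ^ j %% m = e j)%N.
Proof.
move=> m0.
pose dg (i : 'I_(m ^ d)) : {ffun 'I_d -> 'I_m} :=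
  [ffun j : 'I_d => Ordinal (ltn_pmod (i %/ m ^ j) m0)].
have dgi : injective dg.
  move=> i i' /ffunP H; apply/val_inj; apply: (@digits_inj m d) => [||j jd]; rewrite ?ltn_ord//.
  by have := H (Ordinal jd); rewrite !ffunE => /(congr1 val).
have [ix k1 k2] : bijective dg.
  by apply: inj_card_bij => //; rewrite card_ffun !card_ord.
exists ix; first by exists dg.
by move=> e j; rewrite -{2}[e]k2 ffunE.
Qed.

Lemma card_near_le (m w : nat) (S : pred 'I_m) :
  (forall e e', S e -> S e' -> (e - e' <= w)%N) -> (#|S| <= w.+1)%N.
Proof.
move=> H; case: (pickP S) => [e0 Se0|S0]; last by rewrite eq_card0.
case: (arg_minnP (fun e : 'I_m => val e) Se0) => e1 Se1 min1.
rewrite -[w.+1]card_ord.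
apply: (@leq_trans #|fintype.image_mem (fun e : 'I_m => inord (e - e1) : 'I_w.+1) (mem S)|).
  rewrite card_in_image// => e e' Se Se' /(congr1 val).
  rewrite /= !inordK ?ltnS ?H// => /eqP.
  by rewrite eqn_sub2rE ?min1// => /eqP/val_inj.
exact: max_card.
Qed.

(** The sum is at most the number of integers [e + 1] at distance less than [m * h] from [m * y]. *)
Lemma sum_bump_le (R : realType) (g : R -> R) (m : nat) (y h : R) :
  (0 < m)%N -> 0 < h ->
  (forall t, 0 <= g t <= 1) -> (forall t, 1 <= `|t| -> g t = 0) ->
  \sum_(e < m) g ((e.+1%:R / m%:R - y) / h) <= 2 * (m%:R * h) + 1.
Proof.
move=> m0 h0 g01 gs.
have M0 : 0 < m%:R :> R by rewrite ltr0n.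
have mh0 : 0 < m%:R * h by rewrite mulr_gt0.
pose S : pred 'I_m := fun e => `|(e.+1%:R / m%:R - y) / h| < 1.
have SE (e : 'I_m) : S e -> `|e.+1%:R - m%:R * y| < m%:R * h.
  rewrite /S -(ltr_pM2l mh0) mulr1 => H; apply: le_lt_trans H.
  rewrite -{1}(gtr0_norm mh0) -normrM le_eqVlt; apply/orP; left; apply/eqP; congr `|_|.
  by field; rewrite !gt_eqF.
apply: (@le_trans _ _ #|S|%:R).
  rewrite -sum1_card natr_sum big_mkcond [leRHS]big_mkcond/=; apply: ler_sum => e _.
  case: ifPn => [_|]; first by have /andP[] := g01 ((e.+1%:R / m%:R - y) / h).
  by rewrite -leNgt => /gs ->.
have H : (#|S| <= (Num.truncn (2 * (m%:R * h))).+1)%N.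
  apply: card_near_le => e e' Se Se'.
  have [ee|/ltnW ee] := leqP e e'; first by rewrite (eqP (ee : (e - e' == 0)%N)).
  rewrite truncn_ge_nat ?mulr_ge0 ?ltW// natrB//.
  have := SE _ Se; have := SE _ Se'; rewrite !ltr_norml -!natr1 => /andP[? ?] /andP[? ?].
  lra.
apply: (@le_trans _ _ (Num.truncn (2 * (m%:R * h))).+1%:R); first by rewrite ler_nat.
by rewrite -natr1 lerD2r truncn_le// mulr_ge0 ?ltW.
Qed.

Section lower_bound.
Variables (R : realType) (d : nat).
Context {disp : measure_display} {T : measurableType disp}.
Variables (P : probability T R) (U : nat -> {RV P >-> R}).
Hypothesis d0 : (0 < d)%N.
Hypothesis hU : iid_uniform U.
Variables (y : 'rV[R]_d) (q : R).
Hypothesis q1 : 1 <= q.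

Lemma measurable_observations (f : 'rV[R]_d -> R) m :
  measurable_fun setT (observations U f m).
Proof.
apply/measurable_fun_tnthP => i.
rewrite (_ : _ \o _ = (fun w => f (design i) * U i w)).
  exact: measurable_funM.
by apply/funext => w /=; rewrite tnth_mktuple.
Qed.

Lemma measurable_loss (fhat : estimator) (f : 'rV[R]_d -> R) m (c : R) :
  measurable_fun setT
    (fun w => (`|fhat (m ^ d)%N (observations U f m w) - c| `^ q)%:E).
Proof.
apply/measurable_EFinP; apply: (measurableT_comp (measurable_powR q)).
apply: (measurableT_comp (@normr_measurable R setT)).
apply: measurable_funB => //.
have H : measurable_fun setT (fhat (m ^ d)%N \o observations U f m).
  apply: measurableT_comp; [exact: measurable_funP|exact: measurable_observations].
exact: H.
Qed.

Lemma risk_ge (fhat : estimator) m F f : F f ->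
  (\int[P]_w (`|fhat (m ^ d)%N (observations U f m w) - f y| `^ q)%:E <=
   risk U y q fhat m F)%E.
Proof.
move=> Ff; apply: ereal_sup_ubound; exists f => //.
by rewrite unlock.
Qed.

Lemma powRD_le (a b : R) : 0 <= a -> 0 <= b -> (a + b) `^ q <= 2 `^ q * (a `^ q + b `^ q).
Proof.
move=> a0 b0; have q0 : 0 <= q by apply: le_trans q1.
wlog ab : a b a0 b0 / a <= b.
  move=> W; have [/W|/ltW/W] := leP a b; first exact.
  by rewrite addrC [_ `^ q + _]addrC; apply.
apply: (@le_trans _ _ ((2 * b) `^ q)).
  by apply: ge0_ler_powR; rewrite ?nnegrE//; lra.
rewrite powRM// ler_wpM2l ?powR_ge0// lerDr powR_ge0//.
Qed.

Lemma expR_le_1B (x : R) : 0 <= x <= 2^-1 -> expR (- (2 * x)) <= 1 - x.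
Proof.
move=> /andP[x0 x1]; rewrite expRN.
have H := expR_ge1Dx (2 * x); have p : 0 < 1 + 2 * x by lra.
apply: (@le_trans _ _ (1 + 2 * x)^-1).
  by rewrite lef_pV2 ?posrE ?expR_gt0.
by rewrite -[leLHS]mul1r ler_pdivrMr//; nra.
Qed.

Let q0 : 0 < q. Proof. exact: lt_le_trans ltr01 q1. Qed.

(** At [y] the two functions differ by [lam * h ^ beta], so the two losses add up to at least that.
    Both are integrated under the bump function, and only the loss at the constant is transferred to
    the law of the constant, at the price of the exponential. The condition [1 <= m * h] absorbs the
    additive 1 of the point count. *)
Lemma two_point_bound (beta gamma L M A : R) : 0 < beta -> 0 < gamma ->
  0 < L -> 0 < A -> A < M ->
  exists lam K : R, [/\ 0 < lam, 0 < K & forall (fhat : estimator) (m : nat) (h : R),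
    (0 < m)%N -> 0 < h <= 1 -> 1 <= m%:R * h ->
    (((lam * h `^ beta) `^ q)%:E <= (2 `^ q)%:E *
      ((expR (K * (m%:R * h) ^+ d * h `^ beta))%:E *
        risk U y q fhat m (holder_lb gamma L M A) +
       risk U y q fhat m (holder_lb beta L M A)))%E].
Proof.
move=> b0 c0 L0 A0 AM.
have [lamb lamb0 Hb] := holder_lb_perturbation y d0 b0 L0 A0 AM.
have [lamg lamg0 Hg] := holder_lb_perturbation y d0 c0 L0 A0 AM.
pose c := (A + M) / 2; have cc : 0 < c by rewrite /c; lra.
(* The bound [c / 2] keeps the relative depths [u i] below [1 / 2], as needed for [expR_le_1B]. *)
pose lam := Num.min lamb (c / 2).
have lam0 : 0 < lam by rewrite lt_min lamb0 divr_gt0.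
(* The 2 comes from [expR_le_1B], [lam / c] is the relative depth, and [3 ^+ d] comes from
   [2 * (m * h) + 1 <= 3 * (m * h)] in each coordinate. *)
pose K := 2 * lam / c * 3 ^+ d.
have K0 : 0 < K by rewrite /K mulr_gt0 ?exprn_gt0// divr_gt0// mulr_gt0.
exists lam, K; split=> // fhat m h m0 /andP[h0 h1] mh.
pose g := spline (R:=R) (sfloor beta).+1 0.
pose B (x : 'rV[R]_d) := \prod_j g ((x ord0 j - y ord0 j) / h).
have B01 x : 0 <= B x <= 1.
  apply/andP; split.
    apply: prodr_ge0 => j _.
    by have /andP[] := spline0_ge0_le1 (sfloor beta).+1 ((x ord0 j - y ord0 j) / h).
  apply: (@le_trans _ _ (\prod_(j < d) 1)); last by rewrite big1.
  by apply: ler_prod => j _; exact: spline0_ge0_le1.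
have hb1 : h `^ beta <= 1.
  by rewrite -[leRHS](powRr0 h); apply: ger_powR; rewrite ?h0//= ltW.
have hb0 : 0 <= h `^ beta by rewrite powR_ge0.
pose f1 (x : 'rV[R]_d) := c - lam * h `^ beta * B x.
have Hf1 : holder_lb beta L M A f1.
  by apply: Hb; rewrite ?h0// ltW//= /lam ge_min lexx.
(* The constant is a perturbation of height 0. *)
have Hf0 : holder_lb gamma L M A (cst c : 'rV[R]_d -> R).
  have := Hg 0 1; rewrite lexx ltr01 lexx (ltW lamg0) => /(_ isT isT).
  rewrite [X in holder_lb _ _ _ _ X -> _](_ : _ = cst c)//.
  by apply/funext => x; rewrite mul0r mul0r subr0.
pose u i := lam / c * h `^ beta * B (design (i : 'I_(m ^ d))).
have lc : lam / c <= 2^-1.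
  by rewrite ler_pdivrMr// mulrC /lam ge_min lexx orbT.
have lc0 : 0 <= lam / c by rewrite divr_ge0// ltW.
have u0 i : 0 <= u i <= 2^-1.
  have /andP[B0 B1] := B01 (design i).
  apply/andP; split; first exact: mulr_ge0 (mulr_ge0 lc0 hb0) B0.
  apply: le_trans lc; rewrite /u -mulrA ler_piMr//.
  exact: mulr_ile1.
pose a i := 1 - u i.
have a01 i : 0 < a i <= 1 by have := u0 i; rewrite /a; lra.
have f1a i : f1 (design i) = c * a i.
  by rewrite /f1 /a /u; field; rewrite gt_eqF.
pose loss f s w := (`|fhat (m ^ d)%N (observations U f m w) - s| `^ q)%:E.
have loss0 f s w : (0 <= loss f s w)%E by rewrite lee_fin powR_ge0.
have step1 : ((\prod_i a i)%:E * \int[P]_w loss f1 c w <=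
    risk U y q fhat m (holder_lb gamma L M A))%E.
  apply: le_trans (risk_ge fhat m Hf0).
  pose G (t : (m ^ d).-tuple R) : \bar R :=
    (`|fhat (m ^ d)%N [tuple c * tnth t i | i < m ^ d] - c| `^ q)%:E.
  have mG : measurable_fun setT G.
    apply/measurable_EFinP; apply: (measurableT_comp (measurable_powR q)).
    apply: (measurableT_comp (@normr_measurable R setT)).
    apply: measurable_funB => //; apply: (measurableT_comp (measurable_funP (fhat _))).
    apply/measurable_fun_tnthP => i.
    rewrite (_ : _ \o _ = (fun t => c * tnth t i)).
      by apply: measurable_funM => //; exact: measurable_tnth.
    by apply/funext => w /=; rewrite tnth_mktuple.
  have G0 t : (0 <= G t)%E by rewrite lee_fin powR_ge0.
  have := scaled_sample_integral_le hU a01 mG G0.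
  have -> : (fun w => G (scaled_sample U a w)) = loss f1 c.
    apply/funext => w; rewrite /G /loss; congr (`|fhat _ _ - _| `^ _)%:E.
    by apply/eq_mktuple => i; rewrite tnth_mktuple f1a mulrA.
  have -> // : (fun w => G (scaled_sample U (fun=> 1) w)) = loss (cst c) c.
  apply/funext => w; rewrite /G /loss; congr (`|fhat _ _ - _| `^ _)%:E.
  by apply/eq_mktuple => i; rewrite tnth_mktuple mul1r.
have step2 : expR (- (K * (m%:R * h) ^+ d * h `^ beta)) <= \prod_i a i.
  apply: (@le_trans _ _ (\prod_i expR (- (2 * u i)))); last first.
    by apply: ler_prod => i _; rewrite expR_ge0 expR_le_1B.
  rewrite -expR_sum ler_expR sumrN lerN2 -mulr_sumr /u -mulr_sumr.
  have [ix ixb ixE] := digits_bij d m0.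
  rewrite (reindex ix); last exact: onW_bij.
  have -> : \sum_e B (design (ix e)) =
      \prod_(j < d) \sum_(e < m) g ((e.+1%:R / m%:R - y ord0 j) / h).
    rewrite bigA_distr_bigA/=; apply: eq_bigr => e _; apply: eq_bigr => j _.
    by rewrite mxE ixE.
  have S3 : \prod_(j < d) \sum_(e < m) g ((e.+1%:R / m%:R - y ord0 j) / h) <=
      (3 * (m%:R * h)) ^+ d.
    rewrite -[X in _ ^+ X]card_ord -prodr_const; apply: ler_prod => j _.
    apply/andP; split.
      apply: sumr_ge0 => e _.
      by have /andP[] := spline0_ge0_le1 (sfloor beta).+1 ((e.+1%:R / m%:R - y ord0 j) / h).
    apply: le_trans (sum_bump_le _ m0 h0 _ _) _ => [t|t|].
    - exact: spline0_ge0_le1.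
    - exact: spline_eq0.
    - lra.
  rewrite /K; move: S3; rewrite exprMn => S3.
  apply: le_trans (_ : 2 * (lam / c * h `^ beta * (3 ^+ d * (m%:R * h) ^+ d)) <= _).
    by rewrite ler_pM2l// ler_wpM2l// mulr_ge0.
  by rewrite le_eqVlt; apply/orP; left; apply/eqP; ring.
have step3 : (\int[P]_w loss f1 c w <=
    (expR (K * (m%:R * h) ^+ d * h `^ beta))%:E *
    risk U y q fhat m (holder_lb gamma L M A))%E.
  apply: le_trans (_ : (expR (K * (m%:R * h) ^+ d * h `^ beta))%:E *
      ((\prod_i a i)%:E * \int[P]_w loss f1 c w) <= _)%E; last first.
    by apply: lee_wpmul2l => //; rewrite lee_fin expR_ge0.
  rewrite muleA -EFinM; apply: lee_pemull; first exact: integral_ge0.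
  rewrite lee_fin; apply: le_trans (_ : expR (K * (m%:R * h) ^+ d * h `^ beta) *
      expR (- (K * (m%:R * h) ^+ d * h `^ beta)) <= _).
    by rewrite -expRD subrr expR0.
  by rewrite ler_wpM2l// expR_ge0.
have step4 := risk_ge fhat m Hf1.
have f1y : f1 y = c - lam * h `^ beta.
  rewrite /f1 /B big1 ?mulr1// => j _; rewrite subrr mul0r; exact: spline00.
apply: le_trans (_ : (2 `^ q)%:E *
    (\int[P]_w loss f1 c w + \int[P]_w loss f1 (f1 y) w) <= _)%E; last first.
  by apply: lee_wpmul2l; [rewrite lee_fin powR_ge0|exact: leeD].
have mloss s : measurable_fun setT (loss f1 s) by exact: measurable_loss.
have mS : measurable_fun setT (fun w => loss f1 c w + loss f1 (f1 y) w)%E.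
  exact: emeasurable_funD.
rewrite -ge0_integralD// -ge0_integralZl_EFin ?powR_ge0//; last first.
  by move=> w _; rewrite adde_ge0.
apply: le_trans (_ : \int[P]_w ((lam * h `^ beta) `^ q)%:E <= _)%E.
  by rewrite integral_cst//= probability_setT mule1.
apply: ge0_le_integral => //.
- by move=> w _; rewrite lee_fin powR_ge0.
- exact: measurable_funeM.
move=> w _; rewrite /loss -EFinD -EFinM lee_fin.
apply: le_trans (powRD_le _ _) => //.
apply: ge0_ler_powR; rewrite ?nnegrE ?addr_ge0 ?mulr_ge0 ?(ltW q0) ?(ltW lam0)//.
rewrite f1y; set z := fhat _ _.
have E : lam * h `^ beta = `|(z - (c - lam * h `^ beta)) - (z - c)|.
  by rewrite (_ : _ - _ = lam * h `^ beta) ?ger0_norm ?mulr_ge0 ?(ltW lam0)//; ring.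
by rewrite {1}E [leRHS]addrC; exact: ler_normB.
Qed.

End lower_bound.

(** * Lower bounds for admissible families *)

Lemma powR_le_inv (R : realType) (q a b : R) : 0 < q -> 0 <= a -> 0 <= b ->
  a `^ q <= b `^ q -> a <= b.
Proof.
move=> q0 a0 b0; apply: contraTT; rewrite -!ltNge => ba.
by apply: gt0_ltr_powR; rewrite ?nnegrE.
Qed.

Lemma limn_esup_ltyP (R : realType) (u : nat -> \bar R) :
  (limn_esup u < +oo)%E ->
  exists2 C : R, 0 < C & \forall m \near \oo, (u m <= C%:E)%E.
Proof.
rewrite /limn_esup /limf_esup => /ereal_inf_lt[_ [A FA <-]].
set s := ereal_sup _ => slty.
have us m : A m -> (u m <= s)%E by move=> Am; apply: ereal_sup_ubound; exists m.
have [C C0 sC] : exists2 C : R, 0 < C & (s <= C%:E)%E.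
  case: (s) slty => [r _|//|_]; last by exists 1; rewrite ?ltr01 ?leNye.
  exists (Num.max 1 r); first by rewrite lt_max ltr01.
  by rewrite lee_fin le_max lexx orbT.
exists C => //; apply: filterS FA => m Am.
exact: le_trans (us m Am) sC.
Qed.

Lemma limn_esup_lty (R : realType) (u : nat -> \bar R) (C : R) :
  (\forall m \near \oo, (u m <= C%:E)%E) -> (limn_esup u < +oo)%E.
Proof.
move=> H; apply: le_lt_trans (ltry C).
apply: (@le_trans _ _ (ereal_sup (u @` [set m | (u m <= C%:E)%E]))).
  by apply: ereal_inf_lbound; exists [set m | (u m <= C%:E)%E].
by apply: ge_ereal_sup => _ [m ? <-].
Qed.

Lemma limn_einf_gt0 (R : realType) (u : nat -> R) (c : R) : 0 < c ->
  (\forall m \near \oo, c <= u m) -> (0 < limn_einf (fun m => (u m)%:E))%E.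
Proof.
move=> c0 H; apply: (@lt_le_trans _ _ c%:E); first by rewrite lte_fin.
rewrite /limn_einf leeNr.
apply: (@le_trans _ _ (ereal_sup ((\- (fun m => (u m)%:E))%E @` [set m | c <= u m]))).
  by apply: ereal_inf_lbound; exists [set m | c <= u m].
apply: ge_ereal_sup => _ [m /= cu <-].
by rewrite /= -?EFinN lee_fin lerN2.
Qed.

Section rates.
Variables (R : realType) (d : nat).
Context {disp : measure_display} {T : measurableType disp}.
Variables (P : probability T R) (U : nat -> {RV P >-> R}).
Hypothesis d0 : (0 < d)%N.
Hypothesis hU : iid_uniform U.
Variables (y : 'rV[R]_d) (q : R).
Hypothesis q1 : 1 <= q.

Let q0 : 0 < q. Proof. exact: lt_le_trans ltr01 q1. Qed.

Lemma admissible_risk (fhat : estimator) (psi : nat -> R) F :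
  (forall m, (0 < m)%N -> 0 < psi m) ->
  (limn_esup (fun m => (psi m `^ (- q))%:E * risk U y q fhat m F) < +oo)%E ->
  exists2 C : R, 0 < C & \forall m \near \oo, (risk U y q fhat m F <= (C * psi m `^ q)%:E)%E.
Proof.
move=> psi0 /limn_esup_ltyP[C C0 HC]; exists C => //.
near=> m; have m0 : (0 < m)%N by near: m; exists 1%N.
have p0 : 0 < psi m `^ q by rewrite powR_gt0// psi0.
have : ((psi m `^ (- q))%:E * risk U y q fhat m F <= C%:E)%E by near: m.
by rewrite powRN lee_pdivrMl// -EFinM mulrC.
Unshelve. all: by end_near. Qed.

(** The substitution [t = h ^ (beta + d)] turns the exponential cost into [n * t] and the separation
    into a power of [t] with the exponent of the rates. *)
Lemma two_point_rate (beta gamma L M A : R) : 0 < beta -> 0 < gamma ->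
  0 < L -> 0 < A -> A < M ->
  exists lam K : R, [/\ 0 < lam, 0 < K & forall (fhat : estimator) (m : nat) (t : R),
    (0 < m)%N -> 0 < t <= 1 -> 1 <= m%:R `^ (beta + d%:R) * t ->
    (((lam * t `^ (beta / (beta + d%:R))) `^ q)%:E <= (2 `^ q)%:E *
      ((expR (K * ((m ^ d)%N%:R * t)))%:E *
        risk U y q fhat m (holder_lb gamma L M A) +
       risk U y q fhat m (holder_lb beta L M A)))%E].
Proof.
move=> b0 c0 L0 A0 AM.
have [lam [K [lam0 K0 H]]] := two_point_bound d0 hU y q1 b0 c0 L0 A0 AM.
exists lam, K; split=> // fhat m t m0 /andP[t0 t1] mt.
have bd0 : 0 < beta + d%:R by rewrite ltr_wpDr.
pose h := t `^ (beta + d%:R)^-1.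
have h0 : 0 < h by rewrite powR_gt0.
have hbd : h `^ (beta + d%:R) = t by rewrite /h -powRrM mulVf ?gt_eqF// powRr1 ?ltW.
have hb : h `^ beta = t `^ (beta / (beta + d%:R)) by rewrite /h -powRrM mulrC.
have h1 : h <= 1.
  by apply: (powR_le_inv bd0) => //; [exact: ltW|rewrite hbd powR1].
have mh : 1 <= m%:R * h.
  apply: (powR_le_inv bd0) => //; first by rewrite mulr_ge0// ltW.
  by rewrite powR1 powRM ?(ltW h0)// hbd.
have := H fhat m h m0; rewrite h0 h1 hb => /(_ isT mh).
rewrite (_ : K * _ * _ = K * ((m ^ d)%N%:R * t))//.
rewrite -mulrA; congr (_ * _); rewrite exprMn natrX -mulrA -hb; congr (_ * _).
by rewrite -hbd powRD ?powR_mulrn ?(ltW h0)//; [rewrite mulrC|rewrite (gt_eqF h0) implybT].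
Qed.

(** Both functions are taken in the same class and [t = 1 / n], for which the exponential factor is
    a constant. *)
Lemma minimax_lower_bound (alpha L M A C : R) (fhat : estimator) (psi : nat -> R) :
  0 < alpha -> 0 < L -> 0 < A -> A < M -> 0 < C ->
  (forall m, (0 < m)%N -> 0 < psi m) ->
  (\forall m \near \oo, (risk U y q fhat m (holder_lb alpha L M A) <= (C * psi m `^ q)%:E)%E) ->
  exists2 c : R, 0 < c & \forall m \near \oo, c * varphi d alpha (m ^ d) <= psi m.
Proof.
move=> a0 L0 A0 AM C0 psi0 HC.
have [lam [K [lam0 K0 H]]] := two_point_rate a0 a0 L0 A0 AM.
pose D := 2 `^ q * (expR K + 1) * C.
have D0 : 0 < D by rewrite !mulr_gt0 ?powR_gt0// addr_gt0// expR_gt0.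
have Dq0 : 0 < D `^ q^-1 by rewrite powR_gt0.
exists (lam / D `^ q^-1); first by rewrite divr_gt0.
near=> m; have m0 : (0 < m)%N by near: m; exists 1%N.
have n0 : 0 < (m ^ d)%N%:R :> R by rewrite ltr0n expn_gt0 m0.
have psim := psi0 _ m0.
rewrite mulrAC ler_pdivrMr//; apply: (powR_le_inv q0).
- by rewrite mulr_ge0 ?(ltW lam0)// powR_ge0.
- by rewrite mulr_ge0 ?ltW.
rewrite [leRHS]powRM ?(ltW psim) ?(ltW Dq0)//.
rewrite -[(_ `^ _) `^ q]powRrM mulVf ?gt_eqF// (powRr1 (ltW D0)).
have R1 : (risk U y q fhat m (holder_lb alpha L M A) <= (C * psi m `^ q)%:E)%E by near: m.
have ad0 : 0 < alpha + d%:R by rewrite ltr_wpDr.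
have := H fhat m (m ^ d)%N%:R^-1 m0.
rewrite invr_gt0 n0 invf_le1// ler1n expn_gt0 m0 => /(_ isT).
have mm : 1 <= m%:R `^ (alpha + d%:R) * (m ^ d)%N%:R^-1 :> R.
  rewrite natrX powRD; last by rewrite pnatr_eq0 -lt0n m0 implybT.
  rewrite powR_mulrn// mulfK; last by rewrite gt_eqF// exprn_gt0// ltr0n.
  by rewrite -[leLHS](powRr0 m%:R) ler_powR ?ler1n// ltW.
move=> /(_ mm); rewrite divff ?gt_eqF// mulr1.
have -> : (m ^ d)%N%:R^-1 `^ (alpha / (alpha + d%:R)) = varphi d alpha (m ^ d).
  by rewrite /varphi -powR_inv1 ?ltW// -powRrM mulN1r.
move=> H1; rewrite -lee_fin; apply: (le_trans H1).
apply: (@le_trans _ _ ((2 `^ q)%:E * ((expR K)%:E * (C * psi m `^ q)%:E + (C * psi m `^ q)%:E)))%E.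
  apply: lee_wpmul2l; first by rewrite lee_fin powR_ge0.
  by apply: leeD => //; apply: lee_wpmul2l => //; rewrite lee_fin expR_ge0.
rewrite lee_fin le_eqVlt; apply/orP; left; apply/eqP.
by rewrite /D; ring.
Unshelve. all: by end_near. Qed.

End rates.

(** * Size and comparison of [rho] and [phi] *)

Section rate_functions.
Variables (R : realType) (d : nat).
Hypothesis d0 : (0 < d)%N.

Definition rexp (beta : R) : R := beta / (beta + d%:R).

Let dR0 : 0 < d%:R :> R. Proof. by rewrite ltr0n. Qed.

Lemma rexp_gt0 beta : 0 < beta -> 0 < rexp beta.
Proof. by move=> b0; rewrite divr_gt0// addr_gt0. Qed.

Lemma rexp_lt1 beta : 0 < beta -> rexp beta < 1.
Proof. by move=> b0; rewrite ltr_pdivrMr ?addr_gt0// mul1r ltrDl. Qed.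

Lemma rexp_lt beta gamma : 0 < beta -> beta < gamma -> rexp beta < rexp gamma.
Proof.
move=> b0 bg; have g0 := lt_trans b0 bg.
rewrite ltr_pdivrMr ?addr_gt0// mulrAC ltr_pdivlMr ?addr_gt0//.
by rewrite !mulrDr [gamma * beta]mulrC ltrD2l ltr_pM2r.
Qed.

Lemma rhoE (b beta : R) n : (0 < n)%N ->
  rho d b beta n = 1 + (rexp b - rexp beta) * ln n%:R.
Proof.
move=> n0; have N0 : 0 < n%:R :> R by rewrite ltr0n.
rewrite /rho /varphi -powRN -powRD; last by rewrite (gt_eqF N0) implybT.
by rewrite opprK ln_powR [- _ + _]addrC.
Qed.

Section bounds.
Variables (b beta : R) (n : nat).
Hypotheses (n0 : (0 < n)%N) (b0 : 0 < beta) (bb : beta <= b).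

Let r := rho d b beta n.
Let N : R := n%:R.

Let N0 : 0 < N. Proof. by rewrite ltr0n. Qed.
Let lnN0 : 0 <= ln N. Proof. by rewrite ln_ge0// ler1n. Qed.

Lemma rho_ge1 : 1 <= rho d b beta n.
Proof.
rewrite rhoE// lerDl mulr_ge0// subr_ge0.
by move: bb; rewrite le_eqVlt => /predU1P[->//|/(rexp_lt b0)/ltW].
Qed.

Lemma rho_le_ln : rho d b beta n <= 1 + ln n%:R.
Proof.
rewrite rhoE// lerD2l -[leRHS]mul1r ler_wpM2r//.
have := rexp_gt0 b0; have := rexp_lt1 (lt_le_trans b0 bb); lra.
Qed.

Lemma rho_le : rho d b beta n <= n%:R.
Proof.
by apply: (le_trans rho_le_ln); rewrite -[leRHS]lnK ?posrE//; exact: expR_ge1Dx.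
Qed.

(** Makes the left side small for large [n]: [rho <= 4 * expR (rho / 4)] bounds it by
    [4 * expR (3 / 4 * rho) / n], and [rho <= 1 + ln n] leaves a factor [n ^ (- 1 / 4)]. *)
Lemma expR_rho_le : expR (rho d b beta n / 2) * (rho d b beta n / n%:R) <=
  4 * expR (3 / 4 - ln n%:R / 4).
Proof.
have r1 := rho_ge1; have rl := rho_le_ln; rewrite -/r -/N in r1 rl *.
have H1 : r <= 4 * expR (r / 4) by have := expR_ge1Dx (r / 4); lra.
have -> : N = expR (ln N) by rewrite lnK.
rewrite -expRN expRK.
apply: (@le_trans _ _ (expR (r / 2) * (4 * expR (r / 4) * expR (- ln N)))).
  by rewrite ler_pM2l ?expR_gt0// ler_pM2r ?expR_gt0.
rewrite -mulrA mulrCA ler_pM2l// mulrA -!expRD ler_expR; lra.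
Qed.

End bounds.

Lemma phi_gt0 (b beta : R) n : (0 < n)%N -> 0 < beta -> beta <= b -> 0 < phi d b beta n.
Proof.
move=> n0 b0 bb; rewrite powR_gt0// divr_gt0 ?ltr0n//.
by apply: (lt_le_trans ltr01); exact: rho_ge1.
Qed.

(** [rho] decreases in the exponent, so passing from [beta] to [gamma] gains at least the stated
    power of [rho / n]; this gain pays for the change of measure. *)
Lemma phi_le (b beta gamma : R) n : (0 < n)%N -> 0 < beta -> beta < gamma -> gamma <= b ->
  phi d b gamma n <= phi d b beta n * (rho d b beta n / n%:R) `^ (rexp gamma - rexp beta).
Proof.
move=> n0 b0 bg gb.
have g0 := lt_trans b0 bg; have bb := le_trans (ltW bg) gb.
have r1 := rho_ge1 n0 b0 bb; have r1' := rho_ge1 n0 g0 gb.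
have N0 : 0 < n%:R :> R by rewrite ltr0n.
have x0 : 0 < rho d b beta n / n%:R by rewrite divr_gt0//; lra.
rewrite /phi -powRD; last by rewrite (gt_eqF x0) implybT.
rewrite -/(rexp beta) -/(rexp gamma) addrC subrK.
apply: ge0_ler_powR; rewrite ?nnegrE.
- by apply/ltW/rexp_gt0.
- by apply/ltW; rewrite divr_gt0//; lra.
- exact: ltW.
rewrite ler_pM2r ?invr_gt0// !rhoE// lerD2l ler_wpM2r//.
  by rewrite ln_ge0// ler1n.
by have := rexp_lt b0 bg; lra.
Qed.

End rate_functions.

Lemma near_ge (R : realType) (B : R) : \forall m \near \oo, B <= (m%:R : R).
Proof.
exists (Num.truncn B).+1 => // m /= Bm.
by apply/ltW/(lt_le_trans (truncnS_gt B)); rewrite ler_nat.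
Qed.

(** * The trade-off between two exponents *)

Section adaptive.
Variables (R : realType) (d : nat).
Context {disp : measure_display} {T : measurableType disp}.
Variables (P : probability T R) (U : nat -> {RV P >-> R}).
Hypothesis d0 : (0 < d)%N.
Hypothesis hU : iid_uniform U.
Variables (y : 'rV[R]_d) (q : R).
Hypothesis q1 : 1 <= q.

Let q0 : 0 < q. Proof. exact: lt_le_trans ltr01 q1. Qed.

(** With [t = kap * rho / n], the contribution of the smoother class is at most half of the left
    side of the two-point bound, so the class of exponent [beta] carries the other half. The final
    implication is stated for each large [m] separately, so that it can be contraposed at a single
    [m]. *)
Lemma adaptive_lower_bound (b beta gamma L M A Cb Cg : R) (fhat : estimator)
    (psib psig : nat -> R) :
  0 < beta -> beta < gamma -> gamma <= b ->
  0 < L -> 0 < A -> A < M -> 0 < Cb -> 0 < Cg ->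
  (forall m, (0 < m)%N -> 0 < psib m) ->
  (forall m, (0 < m)%N -> 0 < psig m) ->
  (\forall m \near \oo, (risk U y q fhat m (holder_lb beta L M A) <= (Cb * psib m `^ q)%:E)%E) ->
  (\forall m \near \oo, (risk U y q fhat m (holder_lb gamma L M A) <= (Cg * psig m `^ q)%:E)%E) ->
  exists2 c : R, 0 < c & \forall m \near \oo, psig m <= phi d b gamma (m ^ d) ->
    c * phi d b beta (m ^ d) <= psib m.
Proof.
move=> b0 bg gb L0 A0 AM Cb0 Cg0 psib0 psig0 HCb HCg.
have g0 := lt_trans b0 bg; have bb := le_trans (ltW bg) gb.
have [lam [K [lam0 K0 H]]] := two_point_rate d0 hU y q1 b0 g0 L0 A0 AM.
pose eps := rexp d gamma - rexp d beta.
have eps0 : 0 < eps by rewrite subr_gt0; exact: rexp_lt.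
(* Chosen so that [expR (K * kap * r) <= expR (r / 2) ^ (eps * q)], the power in which [expR_rho_le]
   is used; the bound 1 keeps [t <= 1]. *)
pose kap := Num.min 1 (eps * q / (2 * K)).
have kap0 : 0 < kap by rewrite lt_min ltr01 divr_gt0 ?mulr_gt0.
have kap1 : kap <= 1 by rewrite ge_min lexx.
have kapK : K * kap <= eps * q / 2.
  rewrite -ler_pdivlMl//; apply: (@le_trans _ _ (eps * q / (2 * K))).
    by rewrite ge_min lexx orbT.
  by rewrite le_eqVlt; apply/orP; left; apply/eqP; field; rewrite gt_eqF.
pose a := lam * kap `^ rexp d beta.
have a0 : 0 < a by rewrite mulr_gt0// powR_gt0.
have aq0 : 0 < a `^ q by rewrite powR_gt0.
have tq0 : 0 < 2 `^ q :> R by rewrite powR_gt0.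
(* Makes the contribution of the smoother class exactly half of [(a * ph) ^ q]. *)
pose eta := a `^ q / (2 * (2 `^ q * Cg)).
have eta0 : 0 < eta by rewrite divr_gt0// !mulr_gt0.
have eq0 : 0 < eps * q by rewrite mulr_gt0.
pose eta' := eta `^ (eps * q)^-1.
have eta'0 : 0 < eta' by rewrite powR_gt0.
pose D := 2 * (2 `^ q * Cb).
have D0 : 0 < D by rewrite !mulr_gt0.
have Dq0 : 0 < D `^ q^-1 by rewrite powR_gt0.
exists (a / D `^ q^-1); first by rewrite divr_gt0.
near=> m => psigm.
have m0 : (0 < m)%N by near: m; exists 1%N.
have M0 : 0 < m%:R :> R by rewrite ltr0n.
have n0 : (0 < m ^ d)%N by rewrite expn_gt0 m0.
set n := (m ^ d)%N in psigm n0 *.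
have N0 : 0 < n%:R :> R by rewrite ltr0n.
have r1 := rho_ge1 d0 n0 b0 bb.
have rn := rho_le d0 n0 b0 bb.
set r := rho d b beta n in r1 rn *.
have r0 : 0 < r by apply: lt_le_trans r1.
have psibm := psib0 _ m0; have psigm0 := psig0 _ m0.
have ph0 := phi_gt0 d0 n0 b0 bb.
set ph := phi d b beta n in ph0 *.
pose X := expR (r / 2) * (r / n%:R).
have X0 : 0 <= X by rewrite mulr_ge0 ?expR_ge0// divr_ge0// ltW.
have Xeta : X `^ (eps * q) <= eta.
  have -> : eta = eta' `^ (eps * q) by rewrite /eta' -powRrM mulVf ?gt_eqF// powRr1// ltW.
  apply: ge0_ler_powR; rewrite ?nnegrE//; [exact: ltW|exact: ltW|].
  apply: (le_trans (expR_rho_le d0 n0 b0 bb)).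
  rewrite -ler_pdivlMl// -[leRHS]lnK ?posrE ?mulr_gt0 ?invr_gt0// ler_expR.
  (* The threshold solves [3 / 4 - ln m / 4 <= ln (eta' / 4)]; it is enough since [m <= n]. *)
  have : expR (3 - 4 * ln (4^-1 * eta')) <= m%:R :> R by near: m; exact: near_ge.
  rewrite -[X in _ <= X]lnK ?posrE// ler_expR => H1.
  have H2 : ln m%:R <= ln n%:R :> R.
    by rewrite ler_ln ?posrE// ler_nat /n -{1}[m]expn1 leq_pexp2l.
  lra.
rewrite mulrAC ler_pdivrMr//; apply: (powR_le_inv q0).
- by rewrite mulr_ge0 ?ltW.
- by rewrite mulr_ge0 ?ltW.
rewrite [leRHS]powRM ?(ltW psibm) ?(ltW Dq0)//.
rewrite -[(_ `^ _) `^ q]powRrM mulVf ?gt_eqF// (powRr1 (ltW D0)).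
rewrite powRM ?(ltW a0) ?(ltW ph0)//.
have R1 : (risk U y q fhat m (holder_lb beta L M A) <= (Cb * psib m `^ q)%:E)%E by near: m.
have R2 : (risk U y q fhat m (holder_lb gamma L M A) <= (Cg * psig m `^ q)%:E)%E by near: m.
pose t := kap * (r / n%:R).
have rN0 : 0 < r / n%:R by rewrite divr_gt0.
have t0 : 0 < t by rewrite mulr_gt0.
have t1 : t <= 1 by apply: mulr_ile1 => //; [exact: ltW|exact: ltW|rewrite ler_pdivrMr// mul1r].
have mt : 1 <= m%:R `^ (beta + d%:R) * t.
  rewrite powRD; last by rewrite (gt_eqF M0) implybT.
  rewrite powR_mulrn ?(ltW M0)// /t mulrCA /n natrX.
  rewrite -[X in kap * X]mulrA (_ : m%:R ^+ d * (r / m%:R ^+ d) = r); last first.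
    by rewrite mulrC divfK// gt_eqF// exprn_gt0.
  apply: (@le_trans _ _ (kap * m%:R `^ beta)); last first.
    by rewrite ler_pM2l// ler_peMr// powR_ge0.
  rewrite -ler_pdivrMl// mulr1.
  have : (kap^-1) `^ beta^-1 <= m%:R :> R by near: m; exact: near_ge.
  move=> /(ge0_ler_powR (ltW b0)); rewrite !nnegrE powR_ge0 (ltW M0) => /(_ isT isT).
  by rewrite -powRrM mulVf ?gt_eqF// powRr1// invr_ge0 ltW.
have := H fhat m t m0; rewrite t0 t1 => /(_ isT mt).
rewrite -/(rexp d beta) [t `^ _]powRM ?(ltW kap0) ?(ltW rN0)// mulrA -/a -/ph => H1.
have tE : K * (n%:R * t) = K * kap * r by rewrite /t; field; rewrite gt_eqF.
have E1 : expR (K * (n%:R * t)) * (Cg * psig m `^ q) <= Cg * ph `^ q * eta.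
  rewrite tE.
  have S1 : expR (K * kap * r) <= expR (r / 2) `^ (eps * q).
    by rewrite -expRM ler_expR; nra.
  have S2 : psig m `^ q <= ph `^ q * (r / n%:R) `^ (eps * q).
    have -> : ph `^ q * (r / n%:R) `^ (eps * q) = (ph * (r / n%:R) `^ eps) `^ q.
      by rewrite (powRM _ (ltW ph0) (powR_ge0 _ _)) -(powRrM (r / n%:R)).
    apply: ge0_ler_powR; rewrite ?nnegrE ?mulr_ge0 ?powR_ge0 ?(ltW q0) ?(ltW ph0) ?(ltW psigm0)//.
    exact: (le_trans psigm (phi_le d0 n0 b0 bg gb)).
  apply: (@le_trans _ _ (expR (r / 2) `^ (eps * q) * (Cg * (ph `^ q * (r / n%:R) `^ (eps * q))))).
    apply: ler_pM => //; rewrite ?expR_ge0 ?mulr_ge0 ?powR_ge0 ?(ltW Cg0)//.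
    by rewrite ler_pM2l.
  set E := expR (r / 2); set Y := r / n%:R.
  rewrite [leLHS](_ : _ = Cg * ph `^ q * (E `^ (eps * q) * Y `^ (eps * q))); last by ring.
  rewrite ler_pM2l ?mulr_gt0 ?powR_gt0//.
  by rewrite -[leLHS]powRM ?expR_ge0 ?(ltW rN0).
have E2 : (a * ph) `^ q <= 2 `^ q * (Cg * ph `^ q * eta + Cb * psib m `^ q).
  rewrite -lee_fin; apply: (le_trans H1); rewrite EFinM.
  apply: lee_wpmul2l; first by rewrite lee_fin ltW.
  rewrite EFinD; apply: leeD => //.
  apply: (@le_trans _ _ ((expR (K * (n%:R * t)))%:E * (Cg * psig m `^ q)%:E)%E).
    by apply: lee_wpmul2l => //; rewrite lee_fin expR_ge0.
  by rewrite -EFinM lee_fin.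
have E3 : 2 `^ q * (Cg * ph `^ q * eta) = a `^ q * ph `^ q / 2.
  by rewrite /eta; field; rewrite !gt_eqF.
move: E2; rewrite mulrDr E3 powRM ?(ltW a0) ?(ltW ph0)// /D; lra.
Unshelve. all: by end_near. Qed.

End adaptive.

(** * Tensor Lagrange interpolation *)

Section tensor.
Variables (R : realType) (d k : nat).
Let K := k.+1.
Let node := {ffun 'I_d -> 'I_K}.

Definition lag (t : 'I_K) : {poly R} := tnth (lagrange K (fun i : nat => i%:R : R)) t.

Let natr_inj : injective (fun i : nat => i%:R : R).
Proof. by move=> i j /eqP; rewrite eqr_nat => /eqP. Qed.

Lemma lag_interp (p : {poly R}) (u tau : R) : (size p <= K)%N ->
  p.[u] = \sum_(t < K) p.[t%:R + tau] * (lag t).[u - tau].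
Proof.
move=> sp; have -> : p.[u] = (p \Po ('X + tau%:P)).[u - tau].
  by rewrite horner_comp !hornerE subrK.
have sp' : (size (p \Po ('X + tau%:P)) <= K)%N.
  by rewrite size_comp_poly2// size_XaddC.
rewrite {1}(lagrange_gen (ltn0Sn k) natr_inj sp') horner_sum; apply: eq_bigr => t _.
by rewrite hornerM hornerC horner_comp !hornerE.
Qed.

Lemma lag_node (t t' : 'I_K) : (lag t).[t'%:R] = (t == t')%:R.
Proof. exact: (lagrange_sample (ltn0Sn k) natr_inj). Qed.

Lemma size_lag t : (size (lag t) <= K)%N.
Proof. by rewrite (size_lagrange_ (ltn0Sn k) natr_inj). Qed.

(** Polynomials of degree at most [k] in each variable, kept as sums of products so that
    interpolation reduces to one variable. *)
Definition tensor_poly (F : ('I_d -> R) -> R) : Prop :=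
  exists (I : finType) (c : I -> R) (ph : I -> 'I_d -> {poly R}),
    (forall i j, (size (ph i j) <= K)%N) /\
    forall u, F u = \sum_i c i * \prod_j (ph i j).[u j].

Lemma tensor_interp F : tensor_poly F -> forall u tau,
  F u = \sum_(t : node) F (fun j => (t j)%:R + tau j) * \prod_j (lag (t j)).[u j - tau j].
Proof.
move=> [I [c [ph [sph FE]]]] u tau; rewrite FE.
under [RHS]eq_bigr do rewrite FE mulr_suml.
rewrite exchange_big/=; apply: eq_bigr => i _.
under [RHS]eq_bigr do rewrite -mulrA -big_split/=.
rewrite -mulr_sumr; congr (_ * _).
under eq_bigr => j _ do rewrite (@lag_interp _ (u j) (tau j) (sph i j)).
by rewrite bigA_distr_bigA.
Qed.

Lemma tensor_poly_cst (a : R) : tensor_poly (fun=> a).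
Proof.
exists 'I_1, (fun=> a), (fun _ _ => 1); split=> [i j|u].
  by rewrite size_poly1.
by rewrite big_ord1 big1 ?mulr1// => j _; rewrite hornerC.
Qed.

Definition tinterp (c : node -> R) (u : 'I_d -> R) : R :=
  \sum_t c t * \prod_j (lag (t j)).[u j].

Lemma tensor_poly_tinterp c : tensor_poly (tinterp c).
Proof. by exists node, c, (fun (t : node) j => lag (t j)); split=> // t j; exact: size_lag. Qed.

Lemma tinterp_node c (t : node) : tinterp c (fun j => (t j)%:R) = c t.
Proof.
rewrite /tinterp (bigD1 t)//= big1 ?mulr1 => [|j _]; last by rewrite lag_node eqxx.
rewrite big1 ?addr0// => t' tt'.
have [j tj] : exists j, t' j != t j.
  by apply/existsP; apply: contraR tt' => /existsPn H; apply/eqP/ffunP => j; exact/eqP/negPn.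
by rewrite (bigD1 j)//= lag_node (negbTE tj) mul0r mulr0.
Qed.

Lemma tensor_interp0 F : tensor_poly F -> forall u,
  F u = tinterp (fun t => F (fun j => (t j)%:R)) u.
Proof.
move=> HF u; rewrite (tensor_interp HF u (fun=> 0)); apply: eq_bigr => t _.
congr (F _ * _); first by apply/funext => j; rewrite addr0.
by apply: eq_bigr => j _; rewrite subr0.
Qed.

Lemma tinterpB c c' u : tinterp (fun t => c t - c' t) u = tinterp c u - tinterp c' u.
Proof. by rewrite /tinterp -sumrB; apply: eq_bigr => t _; rewrite mulrBl. Qed.

(** The radius [K + 1] covers window coordinates in [[0, K]] as well as nodes translated by at most
    1. *)
Lemma lag_bounded : exists2 B : R, 1 <= B &
  forall t (u : R), `|u| <= K.+1%:R -> `|(lag t).[u]| <= B.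
Proof.
have H t : exists C : R, forall u, `|u| <= K.+1%:R -> `|(lag t).[u]| <= C.
  exact: horner_bounded.
have [C HC] := choice H.
exists (1 + \sum_t `|C t|) => [|t u uK].
  by rewrite lerDl sumr_ge0// => t _.
apply: le_trans (HC t u uK) _; apply: le_trans (ler_norm _) _.
by rewrite (bigD1 t)//= addrCA lerDl addr_ge0// sumr_ge0.
Qed.

Section bounded.
Variable B : R.
Hypothesis B1 : 1 <= B.
Hypothesis HB : forall t (u : R), `|u| <= K.+1%:R -> `|(lag t).[u]| <= B.

Lemma prod_lag_le (t : node) u : (forall j, `|u j| <= K.+1%:R) ->
  `|\prod_j (lag (t j)).[u j]| <= B ^+ d.
Proof.
move=> uK; apply: le_trans (prod_norm_le (b := fun=> B) _) _; first by move=> j; exact: HB.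
by rewrite prodr_const card_ord.
Qed.

Lemma tinterp_le c u : (forall j, `|u j| <= K.+1%:R) ->
  `|tinterp c u| <= B ^+ d * \sum_t `|c t|.
Proof.
move=> uK; apply: le_trans (ler_norm_sum _ _ _) _.
rewrite mulr_sumr; apply: ler_sum => t _.
by rewrite normrM mulrC ler_wpM2r// prod_lag_le.
Qed.

(* The window is a union of translates of the coarse grid of nodes, and [F] at a
   node is interpolated from its values on each of them. *)
Lemma tensor_window F (s : nat) (t0 : node) : tensor_poly F -> (0 < s)%N ->
  `|F (fun j => (t0 j)%:R)| * s%:R ^+ d <= B ^+ d *
    \sum_(w : node * {ffun 'I_d -> 'I_s}) `|F (fun j => (w.1 j)%:R + (w.2 j).+1%:R / s%:R)|.
Proof.
move=> HF s0; have S0 : 0 < s%:R :> R by rewrite ltr0n.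
have -> : `|F (fun j => (t0 j)%:R)| * s%:R ^+ d =
    \sum_(a : {ffun 'I_d -> 'I_s}) `|F (fun j => (t0 j)%:R)|.
  by rewrite sumr_const card_ffun !card_ord -[RHS]mulr_natr natrX.
have -> : \sum_(w : node * {ffun 'I_d -> 'I_s}) `|F (fun j => (w.1 j)%:R + (w.2 j).+1%:R / s%:R)| =
    \sum_(a : {ffun 'I_d -> 'I_s}) \sum_(t : node) `|F (fun j => (t j)%:R + (a j).+1%:R / s%:R)|.
  by rewrite exchange_big/= pair_big.
rewrite mulr_sumr; apply: ler_sum => a _.
rewrite (tensor_interp HF _ (fun j => (a j).+1%:R / s%:R)).
apply: le_trans (ler_norm_sum _ _ _) _; rewrite mulr_sumr; apply: ler_sum => t _.
rewrite normrM mulrC ler_wpM2r//; apply: (le_trans (prod_lag_le t _)) => // j.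
have H1 : 0 <= ((a j).+1%:R : R) / s%:R <= 1.
  by rewrite divr_ge0//= ler_pdivrMr// mul1r ler_nat.
have H2 : (t0 j)%:R + 1 <= K%:R :> R by rewrite natr1 ler_nat.
have H3 : 0 <= (t0 j)%:R :> R := ler0n _ _.
by rewrite ler_norml -natr1; apply/andP; split; lra.
Qed.

End bounded.
End tensor.

(** * Minimal feasible element of a finite net *)

Section net.
Variables (R : realType) (n : nat) (V W : finType).
Variables (wi : W -> 'I_n) (pv : V -> W -> R) (val : V -> R).

Definition feasible (v : V) (t : n.-tuple R) : bool :=
  [forall w, tnth t (wi w) <= pv v w].

Definition score (v : V) : R := \sum_w pv v w.

Definition first_feasible (s : seq V) (t : n.-tuple R) : R :=
  foldr (fun v r => if feasible v t then val v else r) 0 s.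

(** Going through the net by increasing score makes the minimisation a finite cascade of measurable
    tests. The value is 0 when nothing is feasible. *)
Definition net_estimator : n.-tuple R -> R :=
  first_feasible (sort (fun v v' => score v <= score v') (enum V)).

Lemma feasible_setE v : [set t | feasible v t] =
  \bigcap_(w : W) ((fun t => tnth t (wi w)) @^-1` `]-oo, pv v w]%classic).
Proof.
apply/seteqP; split=> t /=.
  by move=> /forallP H w _; rewrite /= in_itv/= H.
by move=> H; apply/forallP => w; have := H w I; rewrite /= in_itv.
Qed.

Lemma measurable_feasible v : measurable_fun setT (feasible v).
Proof.
apply: (measurable_fun_bool true); rewrite setTI.
rewrite (_ : _ @^-1` _ = [set t | feasible v t])//.
rewrite feasible_setE; apply: fin_bigcap_measurable => [|w _].
  exact: finite_finset.
by rewrite -[X in measurable X]setTI; apply: measurable_tnth.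
Qed.

Lemma measurable_net_estimator : measurable_fun setT net_estimator.
Proof.
rewrite /net_estimator; elim: (sort _ _) => [|v s IH].
  exact: measurable_cst.
apply: measurable_fun_ifT => //; exact: measurable_feasible.
Qed.

HB.instance Definition _ :=
  isMeasurableFun.Build _ _ _ _ net_estimator measurable_net_estimator.

Lemma net_estimatorP t :
  (net_estimator t = 0 /\ forall v, ~~ feasible v t) \/
  exists v, [/\ feasible v t, net_estimator t = val v &
                forall v', feasible v' t -> score v <= score v'].
Proof.
suff H s : sorted (fun v v' => score v <= score v') s ->
    (first_feasible s t = 0 /\ forall v, v \in s -> ~~ feasible v t) \/
    exists v, [/\ feasible v t, first_feasible s t = val v &
                forall v', v' \in s -> feasible v' t -> score v <= score v'].
  have tot : total (fun v v' => score v <= score v') by move=> v v'; exact: le_total.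
  have [[E H']|[v [fv E H']]] := H _ (sort_sorted tot (enum V)).
    by left; split=> // v; apply: H'; rewrite mem_sort mem_enum.
  by right; exists v; split=> // v'; apply: H'; rewrite mem_sort mem_enum.
elim: s => [_|v s IH /=]; first by left.
rewrite (path_sortedE (fun a b c => @le_trans _ _ (score a) (score b) (score c))).
move=> /andP[/allP vs ss]; rewrite /first_feasible /= -/(first_feasible s t).
have [fv|nfv] := boolP (feasible v t).
  right; exists v; split=> // v'; rewrite inE => /predU1P[->//|/vs].
  by [].
have [[E H]|[v0 [fv0 E H]]] := IH ss.
  by left; split=> // v'; rewrite inE => /predU1P[->//|/H].
right; exists v0; split=> // v'; rewrite inE => /predU1P[->|].
  by rewrite (negbTE nfv).
exact: H.
Qed.

Lemma net_estimator_bounded (B : R) : 0 <= B -> (forall v, `|val v| <= B) ->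
  forall t, `|net_estimator t| <= B.
Proof.
move=> B0 vB t; have [[-> _]|[v [_ -> _]]] := net_estimatorP t => //.
by rewrite normr0.
Qed.

Context {disp : measure_display} {T : measurableType disp}.
Variables (P : probability T R) (U : nat -> {RV P >-> R}).
Hypothesis hU : iid_uniform U.
Variables (c : 'I_n -> R) (M : R).
Hypothesis wi_inj : injective wi.
Hypothesis c0 : forall i, 0 < c i.
Hypothesis cM : forall i, c i <= M.

Let M0 (w : W) : 0 < M. Proof. exact: lt_le_trans (c0 (wi w)) (cM (wi w)). Qed.

Let sample := scaled_sample U c.

Lemma prob_feasible v : P [set w | feasible v (sample w)] =
  (\prod_w clamp (pv v w / c (wi w)))%:E.
Proof.
(* The constraint put on observation [i]: a single ray if [i] is in the window, by injectivity of
   [wi], and [setT] otherwise. *)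
pose b (i : 'I_n) : set R := \bigcap_(w in [set w | wi w = i]) `]-oo, pv v w / c i]%classic.
have mb i : measurable (b i).
  by apply: fin_bigcap_measurable => [|w _]; [exact: finite_finset|exact: measurable_itv].
have -> : [set w | feasible v (sample w)] = \bigcap_(i : 'I_n) (U i @^-1` b i).
  apply/seteqP; split=> z /=.
    move=> /forallP H i _ w /= wii; have := H w.
    by rewrite tnth_mktuple wii in_itv/= ler_pdivlMr// mulrC.
  move=> H; apply/forallP => w; have := H (wi w) I w erefl.
  by rewrite tnth_mktuple /= in_itv/= ler_pdivlMr// mulrC.
rewrite (uniform_rectangle hU)// (partition_big wi xpredT)//= -prodEFin.
apply: eq_bigr => i _; case: (pickP (fun w => wi w == i)) => [w0 /eqP w0i|H].
  have -> : b i = `]-oo, pv v w0 / c i]%classic.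
    apply/seteqP; split=> z /=; first by apply.
    by move=> H w /= wii; have -> : w = w0 by apply: wi_inj; rewrite wii.
  rewrite (uniform_ray hU); congr EFin; rewrite (bigD1 w0)/=; last by rewrite w0i.
  rewrite big1 ?mulr1 ?w0i// => w /andP[/eqP wii]; rewrite -w0i in wii.
  by rewrite (wi_inj wii) eqxx.
have -> : b i = setT by apply/seteqP; split=> // z _ w /= /eqP; rewrite H.
by rewrite preimage_setT probability_setT big_pred0.
Qed.

(** By [1 + x <= expR x], a factor with [pv < c] is at most [expR (- (c - pv) / c)], and [c <= M];
    the other factors are at most 1. *)
Lemma prob_feasible_le v : (P [set w | feasible v (sample w)] <=
  (expR (- \sum_w Num.max 0 (c (wi w) - pv v w) / M))%:E)%E.
Proof.
rewrite prob_feasible lee_fin -sumrN expR_sum; apply: ler_prod => w _.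
have Mw := M0 w; have cw := c0 (wi w); have cMw := cM (wi w).
apply/andP; split; first by rewrite /clamp le_max lexx.
have [cp|pc] := leP (c (wi w)) (pv v w).
  rewrite max_l ?subr_le0// mul0r oppr0 expR0 /clamp.
  by rewrite ge_max ler01 ge_min lexx.
rewrite max_r ?subr_ge0 ?(ltW pc)// /clamp ge_max expR_ge0/= ge_min; apply/orP; right.
apply: (@le_trans _ _ (expR (pv v w / c (wi w) - 1))).
  by have := expR_ge1Dx (pv v w / c (wi w) - 1); rewrite addrC subrK.
rewrite ler_expR; have -> : pv v w / c (wi w) - 1 = - ((c (wi w) - pv v w) / c (wi w)).
  by field; rewrite gt_eqF.
rewrite lerN2 ler_wpM2l ?subr_ge0 ?(ltW pc)//.
by rewrite lef_pV2 ?posrE.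
Qed.

(* [vs] is feasible only almost surely, since [U i <= 1] holds almost surely. *)
Lemma net_estimator_risk (q s : R) (vs : V) : 0 <= q ->
  (forall w, c (wi w) <= pv vs w) ->
  (\int[P]_z (`|net_estimator (sample z) - s| `^ q)%:E <=
   (\sum_(v | score v <= score vs) `|val v - s| `^ q *
     expR (- \sum_w Num.max 0 (c (wi w) - pv v w) / M))%:E)%E.
Proof.
move=> q0 cvs.
pose E v := [set z | feasible v (sample z)].
have mE v : measurable (E v).
  have := @measurableT_comp _ _ _ _ _ _ (feasible v) setT sample (@measurable_feasible v)
    (measurable_scaled_sample U c).
  by move=> /(_ measurableT [set true] I); rewrite setTI.
have mC := measurableC (mE vs).
have PE : P (~` E vs) = 0.
  rewrite probability_setC// prob_feasible.
  rewrite big1 ?subee// => w _; rewrite /clamp min_l ?max_r//.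
  by rewrite ler_pdivlMr// mul1r.
(* The loss is dominated pointwise by [g]. Where [vs] is feasible, the selected element has no
   larger score and its loss is counted by [k]; elsewhere [B] bounds the loss of every possible
   output, the default 0 included, and multiplies a null event. *)
pose B := \sum_v `|val v - s| `^ q + `|s| `^ q.
have sB0 : 0 <= \sum_v `|val v - s| `^ q by apply: sumr_ge0 => v _; exact: powR_ge0.
have B0 : 0 <= B by rewrite addr_ge0// powR_ge0.
pose k v := if score v <= score vs then `|val v - s| `^ q else 0.
have k0 v : 0 <= k v by rewrite /k; case: ifP => // _; exact: powR_ge0.
pose g z : \bar R := (\sum_v (k v)%:E * (\1_(E v) z)%:E + B%:E * (\1_(~` E vs) z)%:E)%E.
have mk v : measurable_fun setT (fun z => (k v)%:E * (\1_(E v) z)%:E)%E.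
  by apply: measurable_funeM; apply/measurable_EFinP; exact: measurable_indic.
have mB : measurable_fun setT (fun z => B%:E * (\1_(~` E vs) z)%:E)%E.
  by apply: measurable_funeM; apply/measurable_EFinP; exact: measurable_indic.
have mg : measurable_fun setT g by apply: emeasurable_funD => //; exact: emeasurable_sum.
have t0 v z : (0 <= (k v)%:E * (\1_(E v) z)%:E)%E by rewrite mule_ge0// lee_fin.
have tB0 z : (0 <= B%:E * (\1_(~` E vs) z)%:E)%E by rewrite mule_ge0// lee_fin.
apply: (@le_trans _ _ (\int[P]_z g z)%E).
  apply: ge0_le_integral => //.
  - apply/measurable_EFinP; apply: (measurableT_comp (measurable_powR q)).
    apply: (measurableT_comp (@normr_measurable R setT)).
    apply: measurable_funB => //.
    have H : measurable_fun setT (net_estimator \o sample).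
      by apply: measurableT_comp; [exact: measurable_net_estimator|exact: measurable_scaled_sample].
    exact: H.
  - move=> z _; rewrite /g sumEFin -EFinM -EFinD lee_fin.
    have sk0 : 0 <= \sum_v k v * \1_(E v) z by apply: sumr_ge0 => v _; rewrite mulr_ge0.
    have [Evs|nEvs] := pselect (E vs z).
      have [[_ H]|[v [fv -> H]]] := net_estimatorP (sample z).
        by have := H vs; rewrite (Evs : feasible vs (sample z)).
      have sv := H vs Evs.
      apply: (@le_trans _ _ (\sum_v k v * \1_(E v) z)); last first.
        by rewrite lerDl mulr_ge0.
      rewrite (bigD1 v)//= {1}/k sv indicE mem_set// mulr1 lerDl.
      by apply: sumr_ge0 => v' _; rewrite mulr_ge0.
    apply: (@le_trans _ _ B); last first.
      by rewrite [in leRHS]indicE [_ \in ~` _]mem_set// mulr1 lerDr.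
    have [[-> _]|[v [_ -> _]]] := net_estimatorP (sample z).
      by rewrite sub0r normrN lerDr.
    rewrite /B (bigD1 v)//= -addrA lerDl addr_ge0 ?powR_ge0//.
    by apply: sumr_ge0 => v' _; exact: powR_ge0.
rewrite ge0_integralD//=; last 2 first.
- by move=> z _; apply: sume_ge0.
- exact: emeasurable_sum.
rewrite ge0_integral_sum//.
rewrite [X in (_ + X)%E](_ : _ = 0)%E; last first.
  rewrite ge0_integralZl_EFin//; last first.
    by apply/measurable_EFinP; exact: measurable_indic.
  rewrite integral_indic// setIT; move: PE => /= ->; exact: mule0.
rewrite adde0 [in leRHS]big_mkcond -sumEFin/=; apply: lee_sum => v _.
rewrite ge0_integralZl_EFin//; last first.
  by apply/measurable_EFinP; exact: measurable_indic.
rewrite integral_indic ?setIT// /k; case: ifP => _; last by rewrite mul0e.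
rewrite EFinM; apply: lee_wpmul2l; first by rewrite lee_fin powR_ge0.
exact: prob_feasible_le.
Qed.

End net.

(** * Exponential sums and the Holder class *)

(** With truncated subtraction the exponent is the distance of [j] and [x]. The induction bounds
    [1 - r] times the partial sums, which telescope on each side of [x]. *)
Lemma sum_geometric_dist (R : realType) (r : R) (x J : nat) : 0 <= r < 1 ->
  \sum_(j < J) r ^+ (j - x + (x - j)) <= 2 / (1 - r).
Proof.
move=> /andP[r0 r1]; have r1' : 0 < 1 - r by rewrite subr_gt0.
pose S J := \sum_(j < J) r ^+ (j - x + (x - j)).
have SS J' : S J'.+1 = S J' + r ^+ (J' - x + (x - J')) by rewrite /S big_ord_recr.
suff H J' : (1 - r) * S J' <= (if (J' <= x)%N then r ^+ (x.+1 - J') else r + 1 - r ^+ (J' - x)).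
  rewrite ler_pdivlMr// mulrC; apply: (le_trans (H J)).
  have X n : 0 <= r ^+ n <= 1 by rewrite exprn_ge0// exprn_ile1// ltW.
  by case: ifP => _; [have := X (x.+1 - J)%N|have := X (J - x)%N]; lra.
elim: J' => [|J' IH]; first by rewrite /S big_ord0 mulr0 leq0n exprn_ge0.
rewrite SS mulrDr; have [Jx|xJ] := ltnP J' x.
  move: IH; rewrite (ltnW Jx) => IH.
  have -> : (J' - x + (x - J') = x - J')%N by rewrite (eqP (ltnW Jx : (J' - x == 0)%N)).
  rewrite subSS; move: IH; rewrite subSn 1?ltnW// exprS; lra.
have -> : (J' - x + (x - J') = J' - x)%N by rewrite (eqP (xJ : (x - J' == 0)%N)) addn0.
rewrite subSn// exprS; move: IH; case: leqP => [Jx|_].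
  have -> : J' = x by apply/eqP; rewrite eqn_leq Jx xJ.
  by rewrite subSnn subnn expr0 expr1; lra.
lra.
Qed.

Lemma distnE (R : realDomainType) (i j : nat) :
  `|i%:R - j%:R| = (i - j + (j - i))%N%:R :> R.
Proof.
have [ij|ji] := leqP i j.
  by rewrite (eqP (ij : (i - j == 0)%N)) add0n natrB// distrC ger0_norm// subr_ge0 ler_nat.
have ji' := ltnW ji.
by rewrite (eqP (ji' : (j - i == 0)%N)) addn0 natrB// ger0_norm// subr_ge0 ler_nat.
Qed.

(** The sum factors into geometric ones. The bound is free of [J], which will be of the order of the
    inverse mesh. *)
Lemma sum_expR_dist (R : realType) (I : finType) (J : nat) (a : R) (x : I -> nat) :
  0 < a ->
  \sum_(v : {ffun I -> 'I_J}) expR (- (a * \sum_t `|(x t)%:R - (v t)%:R|)) <=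
  (2 / (1 - expR (- a))) ^+ #|I|.
Proof.
move=> a0.
have -> : \sum_(v : {ffun I -> 'I_J}) expR (- (a * \sum_t `|(x t)%:R - (v t)%:R|)) =
    \prod_(t : I) \sum_(j < J) expR (- (a * `|(x t)%:R - j%:R|)).
  rewrite bigA_distr_bigA; apply: eq_bigr => v _.
  by rewrite mulr_sumr -sumrN expR_sum.
rewrite -prodr_const; apply: ler_prod => t _; apply/andP; split.
  by apply: sumr_ge0 => j _; exact: expR_ge0.
apply: le_trans (@sum_geometric_dist R (expR (- a)) (x t) J _).
  apply: ler_sum => j _; rewrite distrC distnE.
  by rewrite -expRM_natl mulrN mulrC.
by rewrite expR_ge0 expR_lt1 oppr_lt0.
Qed.

Lemma powR_le_expR (R : realType) (q a : R) : 0 < q -> 0 < a ->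
  exists2 D : R, 0 < D & forall x, 0 <= x -> (1 + x) `^ q <= D * expR (a * x).
Proof.
move=> q0 a0; pose D := Num.max 1 (q / a).
have D1 : 1 <= D by rewrite le_max lexx.
have D0 : 0 < D := lt_le_trans ltr01 D1.
have DQ : q / a <= D by rewrite le_max lexx orbT.
exists (D `^ q) => [|x x0]; first by rewrite powR_gt0.
have aq0 : 0 < a / q by rewrite divr_gt0.
have -> : a * x = (a / q * x) * q by field; rewrite gt_eqF.
rewrite expRM -powRM ?expR_ge0 ?(ltW D0)//.
apply: ge0_ler_powR; rewrite ?nnegrE ?mulr_ge0 ?expR_ge0 ?(ltW q0) ?(ltW D0)//.
  by rewrite addr_ge0.
apply: (@le_trans _ _ (D * (1 + a / q * x))).
  rewrite mulrDr mulr1 lerD// mulrA ler_peMl//.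
  by move: DQ; rewrite mulrA ler_pdivrMr// ler_pdivlMr// mul1r.
by rewrite ler_pM2l// expR_ge1Dx.
Qed.

Section holder_class.
Variables (R : realType) (d : nat).
Implicit Types (f : 'rV[R]_d -> R).

Lemma mpartial0 k f : mpartial ([ffun=> ord0] : {ffun 'I_d -> 'I_k.+1}) f = f.
Proof.
rewrite /mpartial; elim: (enum 'I_d) => //= j s ->.
by rewrite ffunE.
Qed.

Lemma holder_le (beta L M : R) f x : holder beta L M f -> cube x -> `|f x| <= M.
Proof.
move=> [_ H _] cx; rewrite -lee_fin; apply: le_trans H.
set k := sfloor beta.
rewrite (bigD1 ([ffun=> ord0] : {ffun 'I_d -> 'I_k.+1}))/=; last first.
  by rewrite big1// => j _; rewrite ffunE.
rewrite mpartial0; apply: (@le_trans _ _ (ereal_sup [set `|f z|%:E | z in cube])).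
  by apply: ereal_sup_ubound; exists x.
rewrite leeDl//; apply: sume_ge0 => p _.
apply: (@le_trans _ _ `|mpartial p f x|%:E); first by rewrite lee_fin.
by apply: ereal_sup_ubound; exists x.
Qed.

Lemma holder_lb_ge (beta L M A : R) f x : holder_lb beta L M A f -> cube x -> A <= f x.
Proof.
move=> [_ H] cx; rewrite -lee_fin; apply: le_trans H _.
by apply: ereal_inf_lbound; exists x.
Qed.

End holder_class.

(** * Taylor polynomials on a window of the grid *)

Section taylor_window.
Variables (R : realType) (d : nat) (alpha L M : R) (y : 'rV[R]_d).
Hypothesis d0 : (0 < d)%N.
Hypothesis a0 : 0 < alpha.
Hypothesis L0 : 0 < L.
Hypothesis cy : cube y.
Let k := sfloor alpha.
Let K := k.+1.

Variables (m s : nat) (o : 'I_d -> nat).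
Hypothesis m0 : (0 < m)%N.
Hypothesis s0 : (0 < s)%N.
Hypothesis osK : forall j, (o j + s * K <= m)%N.
Hypothesis oy : forall j, (o j)%:R <= m%:R * y ord0 j <= (o j + s * K)%N%:R.

Let m0R : 0 < m%:R :> R. Proof. by rewrite ltr0n. Qed.
Let s0R : 0 < s%:R :> R. Proof. by rewrite ltr0n. Qed.

(** Coordinates in [[0, K]] on a box with lower corner [o / m] and side [s * K] grid steps; integer
    coordinates, the interpolation nodes, are [s] steps apart. *)
Definition window_point (u : 'I_d -> R) : 'rV[R]_d :=
  \row_j (((o j)%:R + s%:R * u j) / m%:R).

(** The coordinates of [y], which need not be the middle of the window: at the boundary of the cube
    the window is one-sided. *)
Definition window_center (j : 'I_d) : R := (m%:R * y ord0 j - (o j)%:R) / s%:R.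

Lemma window_center_itv j : 0 <= window_center j <= K%:R.
Proof.
have /andP[H1 H2] := oy j; rewrite natrD natrM in H2.
by rewrite /window_center divr_ge0 ?subr_ge0 ?(ltW s0R)//= ler_pdivrMr//; lra.
Qed.

Lemma window_point_center : window_point window_center = y.
Proof.
apply/rowP => j; rewrite mxE /window_center.
by field; rewrite !gt_eqF.
Qed.

Lemma window_point_near u : (forall j, 0 <= u j <= K%:R) ->
  cube (window_point u) /\
  forall j, `|window_point u ord0 j - y ord0 j| <= (s * K)%N%:R / m%:R.
Proof.
move=> uK; split=> j; rewrite mxE.
  have /andP[u0 u1] := uK j.
  rewrite divr_ge0 ?addr_ge0 ?mulr_ge0 ?(ltW s0R)//=.
  rewrite ler_pdivrMr// mul1r.
  apply: (@le_trans _ _ (o j + s * K)%N%:R); last by rewrite ler_nat.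
  by rewrite natrD natrM lerD2l ler_pM2l.
have /andP[u0 u1] := uK j; have /andP[y0 y1] := oy j.
rewrite natrD natrM in y1; rewrite natrM.
have H : s%:R * u j <= s%:R * K%:R by rewrite ler_pM2l.
have H0 : 0 <= s%:R * u j by rewrite mulr_ge0// ltW.
have -> : ((o j)%:R + s%:R * u j) / m%:R - y ord0 j =
    ((o j)%:R + s%:R * u j - m%:R * y ord0 j) / m%:R by field; rewrite gt_eqF.
rewrite normrM [`|m%:R^-1|]gtr0_norm ?invr_gt0// ler_pM2r ?invr_gt0//.
by rewrite ler_norml; apply/andP; split; lra.
Qed.

Definition taylor_at_center (f : 'rV[R]_d -> R) (u : 'I_d -> R) : R :=
  \sum_(p : {ffun 'I_d -> 'I_K} | (\sum_j p j <= k)%N) mpartial p f y *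
     \prod_j ((window_point u ord0 j - y ord0 j) ^+ p j / (p j)`!%:R).

(** [window_point] is affine in each coordinate, and total degree at most [k] bounds the degree in
    each variable. *)
Lemma tensor_poly_taylor f : tensor_poly k (taylor_at_center f).
Proof.
pose q (j : 'I_d) : {poly R} := (s%:R / m%:R) *: 'X + ((o j)%:R / m%:R - y ord0 j)%:P.
exists {ffun 'I_d -> 'I_K},
  (fun p : {ffun 'I_d -> 'I_K} => if (\sum_j p j <= k)%N then mpartial p f y else 0),
  (fun (p : {ffun 'I_d -> 'I_K}) j => ((p j)`!%:R^-1) *: q j ^+ p j).
split=> [p j|u].
  apply: leq_trans (size_scale_leq _ _) _; apply: leq_trans (size_poly_exp_leq _ _) _.
  rewrite ltnS; apply: (@leq_trans (1 * p j)); last by rewrite mul1n -ltnS.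
  rewrite leq_mul2r; apply/orP; right.
  have : (size (q j) <= 2)%N.
    apply: leq_trans (size_polyD _ _) _; rewrite geq_max.
    rewrite (leq_trans (size_scale_leq _ _)) ?size_polyX//=.
    by apply: leq_trans (size_polyC_leq1 _) _.
  by case: (size (q j)).
rewrite /taylor_at_center big_mkcond; apply: eq_bigr => p _.
case: ifP => _; last by rewrite mul0r.
congr (_ * _); apply: eq_bigr => j _.
rewrite hornerZ horner_exp /q !hornerE mxE mulrC; congr (_ * _ ^+ _).
by rewrite /=; field; rewrite gt_eqF.
Qed.

Lemma taylor_at_center_near f (delta C0 : R) u : holder alpha L M f ->
  (forall j, 0 <= u j <= K%:R) ->
  ((s * K)%N%:R / m%:R) `^ alpha <= C0 * delta ->
  `|f (window_point u) - taylor_at_center f u| <= L * d%:R * C0 * delta.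
Proof.
move=> [_ _ H] uK hC.
have [cu un] := window_point_near uK.
apply: (le_trans (H _ _ cu cy)); rewrite -!mulrA ler_pM2l//.
rewrite mulr_natl -[d in _ *+ d]card_ord -sumr_const; apply: ler_sum => j _.
by apply: le_trans hC; apply: ge0_ler_powR; rewrite ?nnegrE ?divr_ge0 ?(ltW a0).
Qed.

End taylor_window.

(** A window point is a coarse cell [w.1] and a fine position [w.2] in it. The successor matches the
    design, whose coordinates start at [1 / m]. *)
Definition grid_coord (R : realType) (d K s : nat)
    (w : {ffun 'I_d -> 'I_K} * {ffun 'I_d -> 'I_s}) (j : 'I_d) : R :=
  (w.1 j)%:R + (w.2 j).+1%:R / s%:R.

Lemma grid_coord_itv (R : realType) (d K s : nat)
    (w : {ffun 'I_d -> 'I_K} * {ffun 'I_d -> 'I_s}) j :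
  0 <= grid_coord R w j <= K%:R.
Proof.
have s0 : 0 < s%:R :> R by rewrite ltr0n (leq_ltn_trans (leq0n (w.2 j))).
have H1 : 0 <= ((w.2 j).+1%:R : R) / s%:R <= 1.
  by rewrite divr_ge0//= ler_pdivrMr// mul1r ler_nat.
have H2 : (w.1 j)%:R + 1 <= K%:R :> R by rewrite natr1 ler_nat.
have H3 : 0 <= (w.1 j)%:R :> R := ler0n _ _.
by rewrite /grid_coord; lra.
Qed.

Lemma grid_indexing (R : realType) (d K m s : nat) (o : 'I_d -> nat) :
  (0 < m)%N -> (0 < s)%N -> (forall j, (o j + s * K <= m)%N) ->
  exists2 wi : {ffun 'I_d -> 'I_K} * {ffun 'I_d -> 'I_s} -> 'I_(m ^ d),
    injective wi & forall w, design (wi w) = window_point m s o (grid_coord R w).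
Proof.
move=> m0 s0 osK; have [ix ixb ixE] := digits_bij d m0.
have em (w : {ffun 'I_d -> 'I_K} * {ffun 'I_d -> 'I_s}) j :
    (o j + (w.1 j * s + w.2 j) < m)%N.
  apply: leq_trans (osK j); rewrite ltn_add2l [(s * K)%N]mulnC.
  apply: (@leq_trans (w.1 j * s + s)%N); first by rewrite ltn_add2l.
  by rewrite -mulSnr leq_mul2r ltn_ord orbT.
pose e w : {ffun 'I_d -> 'I_m} := [ffun j => Ordinal (em w j)].
exists (fun w => ix (e w)) => [w w' /(bij_inj ixb)/ffunP H|w].
  have H' j : w.1 j = w'.1 j /\ w.2 j = w'.2 j.
    have := H j; rewrite !ffunE => /(congr1 val)/= /addnI E.
    split; apply/val_inj.
      by have := congr1 (divn^~ s) E; rewrite !divnMDl// !divn_small// !addn0.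
    by have := congr1 (modn^~ s) E; rewrite !modnMDl !modn_small.
  by case: w w' H' {H} => [a b] [a' b'] /= H'; congr (_, _); apply/ffunP => j; have [] := H' j.
apply/rowP => j; rewrite !mxE ixE ffunE /=; congr (_ / _).
rewrite /grid_coord -addnS natrD -addnS natrD natrM; field.
by rewrite pnatr_eq0 -lt0n.
Qed.

(** * Risk of the window estimator *)

Section stage.
Variables (R : realType) (d : nat) (alpha L M A : R) (y : 'rV[R]_d).
Hypothesis d0 : (0 < d)%N.
Hypothesis a0 : 0 < alpha.
Hypothesis L0 : 0 < L.
Hypothesis A0 : 0 < A.
Hypothesis AM : A < M.
Hypothesis cy : cube y.
Let k := sfloor alpha.
Let K := k.+1.
Let node := {ffun 'I_d -> 'I_K}.

Variables (B C0 c1 : R).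
Hypothesis B1 : 1 <= B.
Hypothesis HB : forall (t : 'I_K) (u : R), `|u| <= K.+1%:R -> `|(lag R t).[u]| <= B.
Hypothesis C00 : 0 < C0.
Hypothesis c10 : 0 < c1.

(* [net_lip] bounds [tinterp c] on the window for node values [`|c| <= 1],
   [net_bias * delta] the error of the Taylor polynomial, and [net_height] the
   node values needed to approximate the class from above. *)
Definition net_lip : R := B ^+ d * #|node|%:R.
Definition net_bias : R := L * d%:R * C0.
Definition net_height : R := M + net_bias + (net_lip + net_bias).

Variables (m s : nat) (o : 'I_d -> nat) (delta : R).
Hypothesis m0 : (0 < m)%N.
Hypothesis s0 : (0 < s)%N.
Hypothesis osK : forall j, (o j + s * K <= m)%N.
Hypothesis oy : forall j, (o j)%:R <= m%:R * y ord0 j <= (o j + s * K)%N%:R.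
Hypothesis delta0 : 0 < delta.
Hypothesis delta1 : delta <= 1.
Hypothesis deltas : c1 <= delta * s%:R ^+ d.
Hypothesis deltas1 : delta * s%:R ^+ d <= 1.
Hypothesis sKm : ((s * K)%N%:R / m%:R) `^ alpha <= C0 * delta.

(** Node values are multiples of [delta] from 0 to about [net_height]; nonnegative ones suffice for
    a positive class. *)
Definition net_size : nat := (Num.truncn (net_height / delta)).+1.
Let V := {ffun node -> 'I_net_size}.

Definition net_fun (v : V) (u : 'I_d -> R) : R :=
  delta * tinterp (fun t => (v t)%:R) u.

Definition net_dist (v v' : V) : R := \sum_t `|(v t)%:R - (v' t)%:R|.

Let wpt := window_point (R := R) m s o.

Let Bd0 : 0 < B ^+ d. Proof. by rewrite exprn_gt0// (lt_le_trans ltr01 B1). Qed.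

Let nn1 : 1 <= #|node|%:R :> R.
Proof. by rewrite ler1n; apply/card_gt0P; exists [ffun=> ord0]. Qed.

Let nn0 : 0 < #|node|%:R :> R := lt_le_trans ltr01 nn1.

Lemma net_lip_gt0 : 0 < net_lip. Proof. by rewrite mulr_gt0. Qed.
Lemma net_bias_gt0 : 0 < net_bias. Proof. by rewrite !mulr_gt0// ltr0n. Qed.
Lemma net_height_gt0 : 0 < net_height.
Proof.
have := net_lip_gt0; have := net_bias_gt0; have := lt_trans A0 AM.
rewrite /net_height; lra.
Qed.

Let uK1 (u : 'I_d -> R) : (forall j, 0 <= u j <= K%:R) ->
  forall j, `|u j| <= K.+1%:R.
Proof.
by move=> uK j; have /andP[u0 u1] := uK j; rewrite ger0_norm// -natr1; lra.
Qed.

(** The Taylor polynomial is raised by [(net_lip + net_bias) * delta] and its node values are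
    rounded down to the mesh. Rounding lowers it by at most [net_lip * delta], and the rest of the
    raise covers the Taylor error, so the result stays above [f]. *)
Lemma net_approx f : holder_lb alpha L M A f ->
  exists vs : V, forall u, (forall j, 0 <= u j <= K%:R) ->
    f (wpt u) <= net_fun vs u <= f (wpt u) + 2 * (net_lip + net_bias) * delta.
Proof.
move=> Hf; have [Hh _] := Hf.
pose Tay := taylor_at_center alpha y m s o f.
pose C1 := net_lip + net_bias.
have l0 := net_lip_gt0; have b0 := net_bias_gt0.
have near u : (forall j, 0 <= u j <= K%:R) ->
    `|f (wpt u) - Tay u| <= net_bias * delta.
  by move=> uK; exact: (taylor_at_center_near a0 L0 cy m0 s0 osK oy Hh uK sKm).
have cw u : (forall j, 0 <= u j <= K%:R) -> cube (wpt u).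
  by move=> uK; have [] := window_point_near m0 s0 osK oy uK.
have node_itv (t : node) j : 0 <= ((t j)%:R : R) <= K%:R.
  by rewrite ler0n ler_nat ltnW.
pose x (t : node) := (Tay (fun j => (t j)%:R) + C1 * delta) / delta.
have x0 t : 0 <= x t <= net_height / delta.
  have := near _ (node_itv t); have := holder_lb_ge Hf (cw _ (node_itv t)).
  have := holder_le Hh (cw _ (node_itv t)).
  rewrite !ler_norml => /andP[_ fM] fA /andP[H1 H2].
  have ld : 0 < net_lip * delta by rewrite mulr_gt0.
  have A0' := A0.
  rewrite /x divr_ge0 ?(ltW delta0)//=; last by rewrite /C1; lra.
  rewrite ler_pM2r ?invr_gt0// /net_height -/C1.
  have H3 : net_bias * delta <= net_bias by rewrite ler_piMr// ltW.
  have H4 : C1 * delta <= C1 by rewrite ler_piMr// /C1 addr_ge0 ?ltW.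
  lra.
have xJ t : (Num.truncn (x t) < net_size)%N.
  rewrite ltnS truncn_le_nat; have /andP[_ xh] := x0 t.
  exact: le_lt_trans xh (truncnS_gt _).
pose vs : V := [ffun t => Ordinal (xJ t)].
exists vs => u uK.
pose r (t : node) := Tay (fun j => (t j)%:R) + C1 * delta - delta * (vs t)%:R.
have r0 t : 0 <= r t <= delta.
  have /andP[x0t _] := x0 t.
  have /andP[H1 H2] := truncn_itv x0t.
  have E : Tay (fun j => (t j)%:R) + C1 * delta = delta * x t.
    by rewrite /x [delta * _]mulrC divfK// gt_eqF.
  rewrite /r E /vs ffunE /= -mulrBr mulr_ge0 ?subr_ge0 ?(ltW delta0)//=.
  by rewrite ler_piMr ?(ltW delta0)//; move: H2; rewrite -natr1; lra.
have rE : tinterp r u = Tay u + C1 * delta - net_fun vs u.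
  have TP : tensor_poly k Tay by exact: tensor_poly_taylor.
  have HT : Tay u = tinterp (fun t : node => Tay (fun j => (t j)%:R)) u.
    exact: tensor_interp0 TP u.
  have HC : C1 * delta = tinterp (fun t : node => C1 * delta) u.
    by rewrite -(tensor_interp0 (tensor_poly_cst _ _ _)).
  rewrite HT [in RHS]HC /net_fun /tinterp mulr_sumr -big_split/= -sumrB.
  by apply: eq_bigr => t _; rewrite /r; ring.
have rle : `|tinterp r u| <= net_lip * delta.
  apply: le_trans (tinterp_le HB _ (uK1 uK)) _.
  rewrite /net_lip -mulrA ler_pM2l// mulr_natl -sumr_const.
  by apply: ler_sum => t _; have /andP[r0t r1t] := r0 t; rewrite ger0_norm.
have := near u uK; move: rle; rewrite !ler_norml rE => /andP[R1 R2] /andP[N1 N2].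
by rewrite /C1 in R1 R2 *; apply/andP; split; nra.
Qed.


Lemma net_funB v v' u : net_fun v u - net_fun v' u =
  delta * tinterp (fun t => (v t)%:R - (v' t)%:R) u.
Proof. by rewrite /net_fun -mulrBr tinterpB. Qed.

Lemma net_dist_ge0 v v' : 0 <= net_dist v v'.
Proof. by apply: sumr_ge0. Qed.

Lemma net_fun_lip v v' u : (forall j, 0 <= u j <= K%:R) ->
  `|net_fun v u - net_fun v' u| <= delta * (B ^+ d * net_dist v v').
Proof.
move=> uK; rewrite net_funB normrM gtr0_norm// ler_pM2l//.
exact: (tinterp_le HB _ (uK1 uK)).
Qed.

Lemma net_fun_bounded v u : (forall j, 0 <= u j <= K%:R) ->
  `|net_fun v u| <= net_lip * (net_height + 1).
Proof.
move=> uK; rewrite /net_fun normrM gtr0_norm//.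
apply: (@le_trans _ _ (delta * (B ^+ d * \sum_(t : node) `|(v t)%:R|))).
  by rewrite ler_pM2l//; exact: (tinterp_le HB _ (uK1 uK)).
rewrite mulrCA /net_lip -mulrA ler_pM2l// mulr_sumr mulr_natl -sumr_const.
have h0 := net_height_gt0.
apply: ler_sum => t _; rewrite ger0_norm//.
apply: (@le_trans _ _ (delta * (net_height / delta + 1))).
  rewrite ler_pM2l//; apply: (@le_trans _ _ (Num.truncn (net_height / delta)).+1%:R).
    by rewrite ler_nat ltnW.
  by rewrite -natr1 lerD2r truncn_le divr_ge0// ltW.
by rewrite mulrDr mulr1 mulrC divfK ?gt_eqF// lerD2l.
Qed.

(** [tensor_window] bounds each node value by the window sum divided by [s ^ d]; the mesh factor and
    [c1 <= delta * s ^ d] make the constant free of [m]. *)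
Lemma net_window_sum v v' :
  c1 / net_lip * net_dist v v' <=
  \sum_(w : node * {ffun 'I_d -> 'I_s}) `|net_fun v (grid_coord R w) - net_fun v' (grid_coord R w)|.
Proof.
set S := \sum_w _.
have SE : S = delta * \sum_(w : node * {ffun 'I_d -> 'I_s})
    `|tinterp (fun t => (v t)%:R - (v' t)%:R) (fun j => (w.1 j)%:R + (w.2 j).+1%:R / s%:R)|.
  by rewrite /S mulr_sumr; apply: eq_bigr => w _; rewrite net_funB normrM gtr0_norm.
have H t : c1 * `|(v t)%:R - (v' t)%:R| <= B ^+ d * S.
  have := tensor_window HB t (tensor_poly_tinterp (fun t => (v t)%:R - (v' t)%:R)) s0.
  rewrite tinterp_node => /(ler_wpM2l (ltW delta0)) H.
  rewrite SE mulrCA; apply: le_trans H; rewrite [delta * _]mulrCA [leRHS]mulrC.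
  by rewrite ler_wpM2r.
rewrite mulrAC ler_pdivrMr ?net_lip_gt0// /net_dist mulr_sumr.
apply: (@le_trans _ _ (\sum_(t : node) B ^+ d * S)); first by apply: ler_sum.
by rewrite sumr_const -[leLHS]mulr_natr /net_lip mulrAC mulrC.
Qed.


Context {disp : measure_display} {T : measurableType disp}.
Variables (P : probability T R) (U : nat -> {RV P >-> R}) (q D : R).
Hypothesis hU : iid_uniform U.
Hypothesis q0 : 0 < q.

Let bias2 : R := 2 * (net_lip + net_bias).
(** [M] comes from [prob_feasible_le], and 2 from bounding a positive part below by half an absolute
    value. *)
Let rate : R := c1 / net_lip / (2 * M).

Hypothesis HD : forall x, 0 <= x -> (1 + x) `^ q <= D * expR (rate / 2 * x).

Variable wi : node * {ffun 'I_d -> 'I_s} -> 'I_(m ^ d).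
Hypothesis wi_inj : injective wi.
Hypothesis wiE : forall w, design (wi w) = wpt (grid_coord R w).

Let M0 : 0 < M. Proof. exact: lt_trans A0 AM. Qed.

(** Depends on none of [m], [s], [o] and [delta], so the risk bound is uniform in the sample
    size. *)
Definition net_risk : R :=
  (B ^+ d + bias2) `^ q * expR (bias2 * #|node|%:R / M) * D *
  (2 / (1 - expR (- (rate / 2)))) ^+ #|node|.

Definition window_estimator : (m ^ d).-tuple R -> R :=
  net_estimator wi (fun v w => net_fun v (grid_coord R w))
    (fun v => net_fun v (window_center y m s o)).

HB.instance Definition _ := isMeasurableFun.Build _ _ _ _ window_estimator
  (measurable_net_estimator wi (fun v w => net_fun v (grid_coord R w))
    (fun v => net_fun v (window_center y m s o))).

Lemma window_estimator_bounded t : `|window_estimator t| <= net_lip * (net_height + 1).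
Proof.
have H0 : 0 <= net_lip * (net_height + 1).
  by rewrite ltW// mulr_gt0 ?net_lip_gt0// addr_gt0// net_height_gt0.
apply: net_estimator_bounded => // v; apply: net_fun_bounded => j.
exact: window_center_itv.
Qed.

Lemma design_cube (i : 'I_(m ^ d)) : cube (design i : 'rV[R]_d).
Proof.
move=> j; rewrite mxE divr_ge0//= ler_pdivrMr ?ltr0n// mul1r ler_nat.
exact: ltn_pmod.
Qed.

(** An element at distance [x] from [vs] has loss of order at most [delta * (1 + x)] and is feasible
    with probability of order at most [expR (- (rate * x))]. Half of the rate absorbs the power [q],
    the other half bounds the sum over the net. *)
Lemma window_estimator_risk f : holder_lb alpha L M A f ->
  (\int[P]_z (`|window_estimator (observations U f m z) - f y| `^ q)%:E <=
   (net_risk * delta `^ q)%:E)%E.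
Proof.
move=> Hf; have [Hh _] := Hf; have [vs Hvs] := net_approx Hf.
have b0 : 0 < bias2 by rewrite /bias2; have := net_lip_gt0; have := net_bias_gt0; lra.
have r0 : 0 < rate by rewrite !divr_gt0 ?net_lip_gt0// mulr_gt0.
pose gc := @grid_coord R d K s.
have fvs w : f (design (wi w)) <= net_fun vs (gc w) <= f (design (wi w)) + bias2 * delta.
  by rewrite wiE; apply: Hvs => j; exact: grid_coord_itv.
have cen j : 0 <= window_center y m s o j <= K%:R by apply: window_center_itv.
have fy : f y <= net_fun vs (window_center y m s o) <= f y + bias2 * delta.
  by have := Hvs _ cen; rewrite /wpt window_point_center.
have f0 i : 0 < f (design (i : 'I_(m ^ d))).
  by apply: (lt_le_trans A0); apply: (holder_lb_ge Hf); exact: design_cube.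
have fM i : f (design (i : 'I_(m ^ d))) <= M.
  by apply: le_trans (ler_norm _) _; apply: (holder_le Hh); exact: design_cube.
have H := net_estimator_risk (pv := fun v w => net_fun v (gc w)) (vs := vs)
  (fun v => net_fun v (window_center y m s o)) hU wi_inj f0 fM (f y) (ltW q0)
  (fun w => proj1 (andP (fvs w))).
apply: (le_trans H); rewrite lee_fin {H}.
apply: (@le_trans _ _ (\sum_(v : V)
    (B ^+ d + bias2) `^ q * expR (bias2 * #|node|%:R / M) * D * delta `^ q *
    expR (- (rate / 2 * net_dist vs v)))); last first.
  rewrite -mulr_sumr /net_risk mulrAC ler_wpM2r ?powR_ge0//.
  have D0 : 0 <= D.
    by have := HD (lexx 0); rewrite addr0 mulr0 expR0 mulr1 powR1; lra.
  rewrite ler_wpM2l ?mulr_ge0 ?powR_ge0 ?expR_ge0//.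
  have r20 : 0 < rate / 2 by rewrite divr_gt0.
  exact: (@sum_expR_dist R node net_size (rate / 2) (fun t => nat_of_ord (vs t)) r20).
rewrite [leLHS]big_mkcond; apply: ler_sum => v _.
have D0 : 0 <= D.
  by have := HD (lexx 0); rewrite addr0 mulr0 expR0 mulr1 powR1; lra.
have dist0 := net_dist_ge0 vs v.
case: ifP => [sv|_]; last by rewrite !mulr_ge0 ?powR_ge0 ?expR_ge0.
have Bb0 := addr_gt0 Bd0 b0.
have step1 : `|net_fun v (window_center y m s o) - f y| `^ q <=
    (B ^+ d + bias2) `^ q * delta `^ q * (D * expR (rate / 2 * net_dist vs v)).
  apply: (@le_trans _ _ (((B ^+ d + bias2) * delta * (1 + net_dist vs v)) `^ q)).
    apply: ge0_ler_powR; rewrite ?nnegrE//; first exact: ltW.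
      by apply: mulr_ge0; [apply/ltW/mulr_gt0|rewrite addr_ge0].
    have := net_fun_lip vs v cen; move: fy; rewrite ler_norml => /andP[F1 F2] /andP[N1 N2].
    have P1 := mulr_ge0 (mulr_ge0 (ltW b0) (ltW delta0)) dist0.
    have P2 := mulr_ge0 (ltW Bd0) (ltW delta0).
    by rewrite ler_norml; apply/andP; split; nra.
  rewrite (powRM _ (ltW (mulr_gt0 Bb0 delta0)) (addr_ge0 ler01 dist0)).
  rewrite (powRM _ (ltW Bb0) (ltW delta0)).
  by rewrite ler_wpM2l ?HD// mulr_ge0 ?powR_ge0.
have step2 : expR (- \sum_w Num.max 0 (f (design (wi w)) - net_fun v (gc w)) / M) <=
    expR (bias2 * #|node|%:R / M) * expR (- (rate * net_dist vs v)).
  rewrite -expRD ler_expR -mulr_suml.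
  have [e Ee] : exists e : R, e = bias2 * delta by exists (bias2 * delta).
  have e0 : 0 < e by rewrite Ee mulr_gt0.
  (* With [x = vs - v], the positive part of [x] is [|x| / 2 + x / 2], and [vs] exceeds [f] by at
     most [e]. The terms [x / 2] have nonnegative sum because the score of [v] is not larger. *)
  have S1 : \sum_w (`|net_fun vs (gc w) - net_fun v (gc w)| / 2 +
      (net_fun vs (gc w) - net_fun v (gc w)) / 2 - e) <=
      \sum_w Num.max 0 (f (design (wi w)) - net_fun v (gc w)).
    apply: ler_sum => w _; have /andP[F1 F2] := fvs w; rewrite -Ee in F2.
    rewrite le_max; apply/orP.
    have [Z|Z] := leP 0 (net_fun vs (gc w) - net_fun v (gc w)).
      by right; rewrite ger0_norm//; lra.
    by left; rewrite ltr0_norm//; lra.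
  rewrite !big_split/= -!mulr_suml sumrB sumr_const in S1.
  have S2 := net_window_sum vs v.
  have S3 : \sum_w net_fun v (gc w) <= \sum_w net_fun vs (gc w) := sv.
  (* The excess of [vs] over [f], summed over the window, stays bounded since
     [delta * s ^ d <= 1]. *)
  have S4 : - e *+ #|{: node * {ffun 'I_d -> 'I_s}}| >= - (bias2 * #|node|%:R).
    rewrite mulNrn lerN2 Ee -[leLHS]mulr_natr card_prod.
    rewrite [X in (_ * X)%N]card_ffun !card_ord natrM natrX.
    rewrite -[leLHS]mulrA ler_pM2l// mulrCA ler_piMr//.
  have S5 : rate * net_dist vs v = c1 / net_lip * net_dist vs v / 2 / M.
    by rewrite /rate; field; rewrite !gt_eqF// net_lip_gt0.
  rewrite S5 -mulrBl -mulNr ler_pM2r ?invr_gt0//.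
  by move: S1 S2 S3 S4; rewrite -/gc; set X := - e *+ _; lra.
apply: le_trans (ler_pM _ _ step1 step2) _; rewrite ?powR_ge0 ?expR_ge0//.
have E : expR (rate / 2 * net_dist vs v) * expR (- (rate * net_dist vs v)) =
    expR (- (rate / 2 * net_dist vs v)).
  by rewrite -expRD; congr expR; field.
rewrite -E le_eqVlt; apply/orP; left; apply/eqP; ring.
Qed.

End stage.

(* An estimator is a family over all [n], while the windows are built for
   [n = m ^ d]. *)
Lemma choose_estimator (R : realType) (d : nat)
    (Q : forall m, {mfun (m ^ d).-tuple R >-> R} -> Prop) : (0 < d)%N ->
  (forall m, exists F, Q m F) ->
  exists fhat : estimator (R := R), forall m, Q m (fhat (m ^ d)%N).
Proof.
move=> d0 HQ.
have H n : exists F : {mfun n.-tuple R >-> R}, forall m (e : n = (m ^ d)%N),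
    Q m (eq_rect n (fun n => {mfun n.-tuple R >-> R}) F _ e).
  have [[m ->]|nm] := pselect (exists m, n = (m ^ d)%N).
    have [F QF] := HQ m; exists F => m' e.
    have mm : m = m' by apply/eqP; rewrite -(eqn_exp2r _ _ d0); apply/eqP.
    by move: e; rewrite -mm => e; rewrite (eq_irrelevance e erefl).
  exists (cst (0 : R) : {mfun n.-tuple R >-> R}) => m e; case: nm; by exists m.
exists (fun n => projT1 (cid (H n))) => m.
exact: (projT2 (cid (H (m ^ d)%N)) m erefl).
Qed.

(** The integer part of [m * y_j], moved down when the window would leave the grid. *)
Lemma window_origin (R : realType) (d m w : nat) (y : 'rV[R]_d) : cube y -> (0 < w <= m)%N ->
  exists o : 'I_d -> nat, forall j, (o j + w <= m)%N /\
    (o j)%:R <= m%:R * y ord0 j <= (o j + w)%N%:R.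
Proof.
move=> cy /andP[w0 wm]; exists (fun j => minn (Num.truncn (m%:R * y ord0 j)) (m - w)) => j.
have /andP[y0 y1] := cy j.
have my0 : 0 <= m%:R * y ord0 j by rewrite mulr_ge0.
have my1 : m%:R * y ord0 j <= m%:R by rewrite ler_piMr.
have /andP[t0 t1] := truncn_itv my0.
split; first by rewrite -(subnK wm) leq_add2r subnK// geq_minr.
apply/andP; split.
  by apply: le_trans t0; rewrite ler_nat geq_minl.
have [tm|tm] := leqP (Num.truncn (m%:R * y ord0 j)) (m - w); last by rewrite subnK.
apply: (le_trans (ltW t1)); rewrite ler_nat -addn1 leq_add2l//.
Qed.

(** * Choice of the window and of the mesh *)

Section minimax.
Variables (R : realType) (d : nat).
Context {disp : measure_display} {T : measurableType disp}.
Variables (P : probability T R) (U : nat -> {RV P >-> R}).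
Hypothesis d0 : (0 < d)%N.
Hypothesis hU : iid_uniform U.

Lemma varphiE (alpha : R) m : varphi d alpha (m ^ d) = (m%:R `^ rexp d alpha) ^- d.
Proof.
rewrite /varphi -/(rexp d alpha) powRN natrX; congr (_^-1).
by rewrite -(powR_mulrn d (ler0n R m)) -(powR_mulrn d (powR_ge0 _ _)) -!powRrM mulrC.
Qed.

(** With [e = alpha / (alpha + d)], take [s] the integer part of [m ^ e] and
    [delta = m ^ (- e * d)]. Then [delta * s ^ d] lies between [2 ^ (- d)] and 1, and the bias
    [(s * K / m) ^ alpha] is at most [C0 * delta]. The bound on the values, for all [m], serves the
    exponents other than [alpha]. *)
Lemma minimax_estimator (y : 'rV[R]_d) (q alpha L M A : R) : cube y -> 0 < q ->
  0 < alpha -> 0 < L -> 0 < A -> A < M ->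
  exists fhat : estimator (R := R), exists2 C : R, 0 < C &
    (forall m t, `|fhat (m ^ d)%N t| <= C) /\
    \forall m \near \oo, forall f, holder_lb alpha L M A f ->
      (\int[P]_z (`|fhat (m ^ d)%N (observations U f m z) - f y| `^ q)%:E <=
       (C * varphi d alpha (m ^ d) `^ q)%:E)%E.
Proof.
move=> cy q0 a0 L0 A0 AM.
have M0 : 0 < M := lt_trans A0 AM.
pose K := (sfloor alpha).+1.
have [B B1 HB] := lag_bounded R (sfloor alpha).
pose C0 : R := K%:R `^ alpha.
have C00 : 0 < C0 by rewrite powR_gt0// ltr0n.
(* Truncating a real number that is at least 1 at most halves it. *)
pose c1 : R := 2^-1 ^+ d.
have c10 : 0 < c1 by rewrite exprn_gt0.
have lip0 := net_lip_gt0 d alpha B1.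
pose rate := c1 / net_lip d alpha B / (2 * M).
have rate0 : 0 < rate / 2 :=
  divr_gt0 (divr_gt0 (divr_gt0 c10 lip0) (mulr_gt0 (ltr0Sn R 1) M0)) (ltr0Sn R 1).
have [D D0 HD] := powR_le_expR q0 rate0.
pose Cb := net_lip d alpha B * (net_height d alpha L M B C0 + 1).
pose Cr := net_risk d alpha L M B C0 c1 q D.
pose C := Num.max 1 (Num.max Cb Cr).
have C1 : 0 < C by rewrite lt_max ltr01.
have CbC : Cb <= C by rewrite /C !le_max lexx orbT.
have CrC : Cr <= C by rewrite /C !le_max lexx !orbT.
pose e := rexp d alpha.
have e0 : 0 < e by exact: rexp_gt0.
have e1 : e < 1 by exact: rexp_lt1.
(* The risk is claimed only once [K <= m ^ (1 - e)], so that the window fits in the grid; for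
   smaller [m] the estimator is 0. *)
pose Q m (F : {mfun (m ^ d).-tuple R >-> R}) := (forall t, `|F t| <= C) /\
  (K%:R `^ (1 - e)^-1 <= m%:R :> R -> (0 < m)%N -> forall f, holder_lb alpha L M A f ->
      (\int[P]_z (`|F (observations U f m z) - f y| `^ q)%:E <=
       (C * varphi d alpha (m ^ d) `^ q)%:E)%E).
have HQ m : exists F, Q m F.
  have [Km|mK] := leP (K%:R `^ (1 - e)^-1) (m%:R : R); last first.
    exists (cst (0 : R) : {mfun (m ^ d).-tuple R >-> R}); split=> [t|H].
      by rewrite /= normr0 ltW.
    by move: mK; rewrite ltNge H.
  have [m0|m0] := leqP m 0.
    exists (cst (0 : R) : {mfun (m ^ d).-tuple R >-> R}); split=> [t|_ H].
      by rewrite /= normr0 ltW.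
    by move: H; rewrite ltnNge m0.
  have m0R : 0 < m%:R :> R by rewrite ltr0n.
  have m1R : 1 <= m%:R :> R by rewrite ler1n.
  pose me : R := m%:R `^ e.
  have me1 : 1 <= me by rewrite -(powRr0 m%:R) /me ler_powR// ltW.
  have me0 : 0 < me := lt_le_trans ltr01 me1.
  pose s := Num.truncn me.
  have /andP[s1 s2] := truncn_itv (ltW me0).
  have s0 : (0 < s)%N by rewrite truncn_gt0.
  have s0R : 1 <= s%:R :> R by rewrite ler1n.
  pose delta := varphi d alpha (m ^ d).
  have dE : delta = me ^- d by rewrite /delta varphiE.
  have delta0 : 0 < delta by rewrite dE invr_gt0 exprn_gt0.
  have delta1 : delta <= 1 by rewrite dE invf_le1 ?exprn_gt0// exprn_ege1.
  have dsE : delta * s%:R ^+ d = (s%:R / me) ^+ d by rewrite dE mulrC expr_div_n.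
  have sme : s%:R / me <= 1 by rewrite ler_pdivrMr// mul1r.
  have sme2 : 2^-1 <= s%:R / me.
    rewrite ler_pdivlMr//; rewrite -/s -natr1 in s2; lra.
  have deltas : c1 <= delta * s%:R ^+ d by rewrite dsE /c1 lerXn2r ?nnegrE//; lra.
  have deltas1 : delta * s%:R ^+ d <= 1 by rewrite dsE exprn_ile1//; lra.
  have Kle : K%:R <= m%:R `^ (1 - e).
    have e1' : 0 < 1 - e by rewrite subr_gt0.
    have := ge0_ler_powR (ltW e1') (powR_ge0 _ _) (ler0n _ _) Km.
    by rewrite -powRrM mulVf ?gt_eqF// powRr1.
  have meE : me * m%:R `^ (1 - e) = m%:R.
    rewrite /me -powRD; last by rewrite (gt_eqF m0R) implybT.
    by rewrite addrC subrK powRr1// ltW.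
  have sKm : (s * K <= m)%N.
    rewrite -(ler_nat R) natrM -meE; apply: ler_pM => //.
  have sKa : ((s * K)%N%:R / m%:R) `^ alpha <= C0 * delta.
    apply: (@le_trans _ _ ((K%:R * (me / m%:R)) `^ alpha)).
      apply: ge0_ler_powR; rewrite ?nnegrE; [exact: ltW| | |].
      - by rewrite divr_ge0.
      - by rewrite mulr_ge0// divr_ge0// ltW.
      by rewrite natrM [s%:R * _]mulrC -mulrA ler_pM2l ?ltr0n// ler_pM2r ?invr_gt0.
    rewrite powRM ?divr_ge0 ?(ltW me0)// ler_pM2l//.
    have m10 : 0 < m%:R `^ (1 - e) :> R by rewrite powR_gt0.
    have -> : me / m%:R = (m%:R `^ (1 - e))^-1.
      by rewrite -[X in _ / X]meE invfM mulrA divff ?mul1r// gt_eqF.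
    rewrite -powR_inv1 ?(ltW m10)// -powRrM mulN1r powRN dE.
    rewrite /me -(powR_mulrn d (powR_ge0 _ _)) -!powRrM.
    rewrite (_ : (1 - e) * alpha = e * d%:R)//.
    by rewrite /e /rexp; field; rewrite gt_eqF// addr_gt0// ltr0n.
  have sK0 : (0 < s * K <= m)%N by rewrite muln_gt0 s0 sKm.
  have [org Horg] := window_origin cy sK0.
  have osK j : (org j + s * K <= m)%N by have [] := Horg j.
  have oy j : (org j)%:R <= m%:R * y ord0 j <= (org j + s * K)%N%:R by have [] := Horg j.
  have [wi wi_inj wiE] := grid_indexing R m0 s0 osK.
  exists (window_estimator L M y B C0 org delta wi : {mfun (m ^ d).-tuple R >-> R}).
  split=> [t|_ _ f Hf].
    apply: le_trans CbC.
    exact: (window_estimator_bounded d0 L0 A0 AM B1 HB C00 s0 oy delta0 delta1).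
  have := window_estimator_risk d0 a0 L0 A0 AM cy B1 HB C00 c10 m0 s0 osK oy delta0 delta1
    deltas deltas1 sKa hU q0 HD wi_inj wiE Hf.
  move=> H; apply: (le_trans H); rewrite lee_fin ler_wpM2r// powR_ge0//.
have [fhat Hfhat] := choose_estimator d0 HQ.
exists fhat, C => //; split=> [m|]; first by have [] := Hfhat m.
near=> m; have [_ H] := Hfhat m; apply: H.
  by near: m; exact: near_ge.
by near: m; exists 1%N.
Unshelve. all: by end_near. Qed.

End minimax.

(** * The theorem *)

Lemma varphi_gt0 (R : realType) d (alpha : R) n : (0 < n)%N -> 0 < varphi d alpha n.
Proof. by move=> n0; rewrite powR_gt0// ltr0n. Qed.

Section admissible_facts.
Variables (R : realType) (d : nat).
Context {disp : measure_display} {T : measurableType disp}.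
Variables (P : probability T R) (U : nat -> {RV P >-> R}).
Hypothesis d0 : (0 < d)%N.
Hypothesis hU : iid_uniform U.
Variables (y : 'rV[R]_d) (b q : R).
Hypothesis cy : cube y.
Hypothesis q1 : 1 <= q.

Let q0 : 0 < q. Proof. exact: lt_le_trans ltr01 q1. Qed.

Lemma admissible_varphi alpha : 0 < alpha <= b ->
  admissible U y q b (fun beta n => if beta == alpha then varphi d alpha n else 1).
Proof.
move=> /andP[a0 ab]; split=> [beta _ m m0|].
  by case: ifP => // _; rewrite varphi_gt0// expn_gt0 m0.
have [fhat [C C0 [Fb Fr]]] :=
  minimax_estimator d0 hU cy q0 a0 (@ltr01 R) (@ltr01 R) (ltr1n R 2).
exists fhat, 1, 2, 1; split=> //; first by rewrite ltr1n.
move=> beta /andP[b0 bb]; case: eqVneq => [->|_].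
  apply: (@limn_esup_lty _ _ C); near=> m.
  have m0 : (0 < m)%N by near: m; exists 1%N.
  have v0 : 0 < varphi d alpha (m ^ d) `^ q.
    by rewrite powR_gt0// varphi_gt0// expn_gt0 m0.
  rewrite powRN lee_pdivrMl// -EFinM mulrC.
  apply: ge_ereal_sup => _ [f Hf <-]; rewrite unlock.
  have H : forall f, holder_lb alpha 1 2 1 f ->
      (\int[P]_z (`|fhat (m ^ d)%N (observations U f m z) - f y| `^ q)%:E <=
       (C * varphi d alpha (m ^ d) `^ q)%:E)%E by near: m.
  exact: H.
apply: (@limn_esup_lty _ _ ((C + 2) `^ q)); near=> m.
(* At the other exponents the normalization is 1, and the loss is bounded since the estimator is at
   most [C] and [f y] at most 2 in absolute value. *)
rewrite powR1 mul1e; apply: ge_ereal_sup => _ [f [Hf _] <-]; rewrite unlock.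
apply: (@le_trans _ _ (\int[P]_z ((C + 2) `^ q)%:E)%E).
  apply: ge0_le_integral => //; first exact: measurable_loss.
  move=> z _; rewrite lee_fin; apply: ge0_ler_powR; rewrite ?nnegrE//; first exact: ltW.
    by rewrite addr_ge0// ltW.
  by apply: le_trans (ler_normB _ _) _; apply: lerD => //; exact: holder_le Hf cy.
by rewrite integral_cst//= probability_setT mule1.
Unshelve. all: by end_near. Qed.

Variable psi : R -> nat -> R.
Hypothesis psi_adm : admissible U y q b psi.

Lemma admissible_gt0 beta m : 0 < beta <= b -> (0 < m)%N -> 0 < psi beta (m ^ d)%N.
Proof. by move=> bb m0; have [H _] := psi_adm; exact: H. Qed.

Lemma admissible_varphi_le alpha : 0 < alpha <= b ->
  exists2 c : R, 0 < c & \forall m \near \oo, c * varphi d alpha (m ^ d) <= psi alpha (m ^ d)%N.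
Proof.
move=> ab; have [_ [fhat [L [M [A [L0 M0 A0 AM H]]]]]] := psi_adm.
have p0 m : (0 < m)%N -> 0 < psi alpha (m ^ d)%N by exact: admissible_gt0.
have [C C0 HC] := admissible_risk p0 (H _ ab).
have /andP[a0 _] := ab.
exact: (minimax_lower_bound d0 hU q1 a0 L0 A0 AM C0 p0 HC).
Qed.

Lemma admissible_phi_le beta gamma : 0 < beta -> beta < gamma -> gamma <= b ->
  exists2 c : R, 0 < c & \forall m \near \oo,
    psi gamma (m ^ d)%N <= phi d b gamma (m ^ d)%N ->
    c * phi d b beta (m ^ d)%N <= psi beta (m ^ d)%N.
Proof.
move=> b0 bg gb; have [_ [fhat [L [M [A [L0 M0 A0 AM H]]]]]] := psi_adm.
have hb : 0 < beta <= b by rewrite b0 (le_trans (ltW bg)).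
have hg : 0 < gamma <= b by rewrite gb (lt_trans b0).
have pb m : (0 < m)%N -> 0 < psi beta (m ^ d)%N by exact: admissible_gt0.
have pg m : (0 < m)%N -> 0 < psi gamma (m ^ d)%N by exact: admissible_gt0.
have [Cb Cb0 HCb] := admissible_risk pb (H _ hb).
have [Cg Cg0 HCg] := admissible_risk pg (H _ hg).
exact: (adaptive_lower_bound d0 hU q1 b0 bg gb L0 A0 AM Cb0 Cg0 pb pg HCb HCg).
Qed.

End admissible_facts.

Theorem theorem3p2 (R : realType) (d : nat) (hd : (1 <= d)%N)
  (disp : measure_display) (T : measurableType disp) (P : probability T R)
  (U : nat -> {RV P >-> R}) (hU : iid_uniform U)
  (y : 'rV[R]_d) (hy : cube y) (b : nat) (hb : (0 < b)%N)
  (q : R) (hq : 1 <= q)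
  (psi : R -> nat -> R) (hpsi : admissible U y q b%:R psi) :
  (forall alpha : R, 0 < alpha <= b%:R ->
     rate_neq (fun m => psi alpha (m ^ d)%N)
              (fun m => varphi d alpha (m ^ d)%N) ->
     exists upsilon : R -> nat -> R,
       admissible U y q b%:R upsilon /\
       (fun m => upsilon alpha (m ^ d)%N / psi alpha (m ^ d)%N) @ \oo
         --> (0 : R))
  /\
  (forall gamma : R, 0 < gamma < b%:R ->
     (fun m => psi gamma (m ^ d)%N / phi d b%:R gamma (m ^ d)%N) @ \oo
       --> (0 : R) ->
     (forall beta : R, 0 < beta < gamma ->
        (0 < limn_einf (fun m => (psi beta (m ^ d)%N /
                                  phi d b%:R beta (m ^ d)%N)%:E))%E)
     /\
     (forall beta : R, gamma < beta <= b%:R ->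
        (fun m => (psi gamma (m ^ d)%N / phi d b%:R gamma (m ^ d)%N) *
                  (phi d b%:R beta (m ^ d)%N / psi beta (m ^ d)%N)) @ \oo
          --> (0 : R))).
Proof.
split=> [alpha ab neq|gamma /andP[g0 gb] small].
  exists (fun beta n => if beta == alpha then varphi d alpha n else 1).
  split; first exact: admissible_varphi.
  have [c c0 Hc] := admissible_varphi_le hd hU hq hpsi ab.
  rewrite eqxx; apply/cvgrPdist_le => e e0.
  (* [C^-1 <= c] leaves [psi > C * varphi] as the only way to differ from [varphi], and [e^-1 <= C]
     then gives the ratio at most [e]. *)
  pose C := Num.max c^-1 e^-1.
  have C0 : 0 < C by rewrite lt_max invr_gt0 c0.
  have HC := neq C C0; near=> m.
  have m0 : (0 < m)%N by near: m; exists 1%N.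
  have v0 : 0 < varphi d alpha (m ^ d)%N by rewrite varphi_gt0// expn_gt0 m0.
  have p0 := admissible_gt0 hpsi ab m0.
  have cv : c * varphi d alpha (m ^ d) <= psi alpha (m ^ d)%N by near: m.
  have NC : ~ (C^-1 * varphi d alpha (m ^ d) <= psi alpha (m ^ d)%N <= C * varphi d alpha (m ^ d)).
    by near: m.
  rewrite sub0r normrN (gtr0_norm (divr_gt0 v0 p0)) ler_pdivrMr//.
  have Cc : C^-1 <= c by rewrite -[leRHS]invrK lef_pV2 ?posrE ?invr_gt0// le_max lexx.
  have Ce : e^-1 <= C by rewrite le_max lexx orbT.
  have [le|lt] := leP (psi alpha (m ^ d)%N) (C * varphi d alpha (m ^ d)).
    by case: NC; rewrite le andbT; apply: le_trans cv; rewrite ler_pM2r.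
  rewrite -ler_pdivrMl//; apply: le_trans (ltW lt).
  by rewrite ler_pM2r.
have small_le e : 0 < e -> \forall m \near \oo,
    psi gamma (m ^ d)%N / phi d b%:R gamma (m ^ d)%N <= e.
  move=> e0; move/cvgrPdist_le: small => /(_ e e0); apply: filterS => m.
  by rewrite sub0r normrN => /(le_trans (ler_norm _)).
split=> [beta /andP[b0 bg]|beta /andP[gbeta bb]].
  have [c c0 Hc] := admissible_phi_le hd hU hq hpsi b0 bg (ltW gb).
  apply: (limn_einf_gt0 c0); near=> m.
  have m0 : (0 < m)%N by near: m; exists 1%N.
  have n0 : (0 < m ^ d)%N by rewrite expn_gt0 m0.
  have pg0 := phi_gt0 hd n0 g0 (ltW gb).
  have pb0 := phi_gt0 hd n0 b0 (ltW (lt_trans bg gb)).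
  rewrite ler_pdivlMr//.
  have imp : psi gamma (m ^ d)%N <= phi d b%:R gamma (m ^ d)%N ->
    c * phi d b%:R beta (m ^ d)%N <= psi beta (m ^ d)%N by near: m.
  have r1 : psi gamma (m ^ d)%N / phi d b%:R gamma (m ^ d)%N <= 1.
    by near: m; exact: small_le.
  by apply: imp; rewrite (ler_pdivrMr _ _ pg0) mul1r in r1.
have [c c0 Hc] := admissible_phi_le hd hU hq hpsi g0 gbeta bb.
have b0 := lt_trans g0 gbeta.
apply/cvgrPdist_le => e e0; near=> m.
have m0 : (0 < m)%N by near: m; exists 1%N.
have n0 : (0 < m ^ d)%N by rewrite expn_gt0 m0.
have pg0 := phi_gt0 hd n0 g0 (ltW gb).
have pb0 := phi_gt0 hd n0 b0 bb.
have psib0 : 0 < psi beta (m ^ d)%N by apply: (admissible_gt0 hpsi) => //; rewrite b0.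
have psig0 : 0 < psi gamma (m ^ d)%N by apply: (admissible_gt0 hpsi) => //; rewrite g0 ltW.
have imp : psi beta (m ^ d)%N <= phi d b%:R beta (m ^ d)%N ->
  c * phi d b%:R gamma (m ^ d)%N <= psi gamma (m ^ d)%N by near: m.
have He : psi gamma (m ^ d)%N / phi d b%:R gamma (m ^ d)%N <= e by near: m; exact: small_le.
have Hc2 : psi gamma (m ^ d)%N / phi d b%:R gamma (m ^ d)%N <= c / 2.
  by near: m; apply: small_le; rewrite divr_gt0.
rewrite sub0r normrN (gtr0_norm (mulr_gt0 (divr_gt0 psig0 pg0) (divr_gt0 pb0 psib0))).
apply: le_trans He; apply: (ler_piMr (ltW (divr_gt0 psig0 pg0))).
rewrite (ler_pdivrMr _ _ psib0) mul1r.
(* If [psi] were below [phi] at [beta], the dichotomy would give [psi / phi >= c] at [gamma], where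
   the ratio is at most [c / 2]. *)
rewrite leNgt; apply/negP => lt.
have X := imp (ltW lt); rewrite -(ler_pdivlMr _ _ pg0) in X.
have := le_trans X Hc2; rewrite leNgt => /negP; apply.
by rewrite ltr_pdivrMr// ltr_pMr// ltr1n.
Unshelve. all: by end_near. Qed.
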